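(* For $m\in\mathbb{N}$ let $\mu_m$ be the $m$-monotone central limit law, i.e. the probability measure on $\mathbb{R}$ whose moments are $M^{(m)}_{2k+1}=0$ and $M^{(m)}_{2k}=|\mathcal{ONC}^2_{2k}(m)|/k!$ ($k\ge0$, with $|\mathcal{ONC}^2_0(m)|=1$), and let $G^{(m)}(z)=\int_{\mathbb{R}}\frac{d\mu_m(x)}{z-x}$ be its Cauchy transform. Then for $z\in\mathbb{C}_+=\{z:\mathrm{Im}\,z>0\}$, $$G^{(1)}(z)=\frac{1}{\sqrt{z^2-2}},\qquad G^{(m)}(z)=\frac{1}{z-G^{(m-1)}(z)}\quad\text{for } m\ge2,$$ where the branch of the square root is the one with $\sqrt{z^2-2}\sim z$ as $z\to\infty$.
   Context: An ordered partition of $\{1,\dots,n\}$ is a tuple $P=(P_1,\dots,P_k)$ of pairwise disjoint nonempty sets (blocks) with union $\{1,\dots,n\}$; the index $r$ is the order (color) of $P_r$, and tuples with the same blocks in different order are different ordered partitions. $P$ is non-crossing if there are no $s<r<s'<r'$ with $s,s'\in P_i$, $r,r'\in P_j$, $i\ne j$. Block $P_i$ is inner w.r.t. $P_j$ (written $P_j<P_i$) if there are $p<q$ in $P_j$ with no element of $P_j$ strictly between them and $p<s<q$ for all $s\in P_i$. The depth $d(P_i)$ is $1$ plus the number of blocks w.r.t. which $P_i$ is inner. $\mathcal{ONC}_n(m)$ is the set of ordered non-crossing partitions $P$ of $\{1,\dots,n\}$ such that for all $i,j$: $d(P_j)\ge m$ and $P_j<P_i$ imply $j<i$; $\mathcal{ONC}^2_n(m)$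 is its subset of partitions with all blocks of size two. *)

(* Defs.v *)
From HB Require Import structures.
From mathcomp Require Import all_boot all_order all_algebra.
From mathcomp Require Import all_classical all_reals all_analysis.
From mathcomp Require Import complex.
Set Implicit Arguments. Unset Strict Implicit. Unset Printing Implicit Defensive.
Import Order.TTheory GRing.Theory Num.Theory.
Local Open Scope ring_scope.

(* Ordered partitions of {1,...,n}, encoded on 'I_n = {0,...,n-1} (same     *)
(* order).  An ordered partition with k blocks (P_0,...,P_{k-1}) is given   *)
(* by f : {ffun 'I_n -> 'I_k} with P_r = f^{-1}(r); the condition that      *)
(* every block is nonempty is [ordered_partition f].                        *)

Definition block (n k : nat) (f : {ffun 'I_n -> 'I_k}) (r : 'I_k) : {set 'I_n} :=
  [set s | f s == r].

Definition ordered_partition (n k : nat) (f : {ffun 'I_n -> 'I_k}) : bool :=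
  [forall r : 'I_k, [exists s : 'I_n, s \in block f r]].

Definition noncrossing (n k : nat) (f : {ffun 'I_n -> 'I_k}) : bool :=
  [forall s : 'I_n, forall r : 'I_n, forall s' : 'I_n, forall r' : 'I_n,
     ~~ [&& (s < r)%N, (r < s')%N, (s' < r')%N, f s == f s', f r == f r' & f s != f r]].

Definition inner (n k : nat) (f : {ffun 'I_n -> 'I_k}) (j i : 'I_k) : bool :=
  [exists p : 'I_n, exists q : 'I_n,
     [&& p \in block f j, q \in block f j, (p < q)%N,
         [forall t : 'I_n, (t \in block f j) ==> ~~ ((p < t)%N && (t < q)%N)] &
         [forall s : 'I_n, (s \in block f i) ==> ((p < s)%N && (s < q)%N)]]].

Definition depth (n k : nat) (f : {ffun 'I_n -> 'I_k}) (i : 'I_k) : nat :=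
  #|[set j : 'I_k | inner f j i]|.+1.

Definition is_ONC (m n k : nat) (f : {ffun 'I_n -> 'I_k}) : bool :=
  [&& ordered_partition f, noncrossing f &
      [forall i : 'I_k, forall j : 'I_k,
         ((m <= depth f j)%N && inner f j i) ==> (j < i)%N]].

Definition pair_blocks (n k : nat) (f : {ffun 'I_n -> 'I_k}) : bool :=
  [forall r : 'I_k, #|block f r| == 2].

(* ONC^2_{2k}(m): an ordered pair partition of {1..2k} has exactly k blocks *)
Definition ONC2 (m k : nat) : {set {ffun 'I_(k.*2) -> 'I_k}} :=
  [set f | is_ONC m f && pair_blocks f].

(* Moments of the m-monotone central limit law:
   M_{2k+1} = 0, M_{2k} = |ONC^2_{2k}(m)| / k!  (|ONC^2_0(m)| = 1 automatically) *)
Definition mmon_moment (R : realType) (m p : nat) : R :=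
  if odd p then 0 else (#|ONC2 m p./2|)%:R / (p./2)`!%:R.

Definition has_mmon_moments (R : realType) (m : nat) (mu : probability R R) : Prop :=
  forall p : nat,
    mu.-integrable setT (fun x : R => (x ^+ p)%:E) /\
    (\int[mu]_x (x ^+ p)%:E = (mmon_moment R m p)%:E)%E.

(* Cauchy transform G(z) = \int dmu(x)/(z - x), written via its real and
   imaginary parts (the integrand is bounded for Im z > 0). *)
Definition cauchy_transform (R : realType) (mu : probability R R) (z : R[i]) : R[i] :=
  Complex (Rintegral mu setT (fun x : R => complex.Re ((z - (x%:C)%C)^-1)))
          (Rintegral mu setT (fun x : R => complex.Im ((z - (x%:C)%C)^-1))).

(* The branch of sqrt(z^2 - 2) with sqrt(z^2-2) ~ z at infinity: on the upper
   half-plane it is the square root with positive imaginary part; sqrtC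
   (algC-style root) always returns the square root with Im >= 0. *)
Definition sqrt_z2m2 (R : realType) (z : R[i]) : R[i] := sqrtC (z ^+ 2 - 2).

(* Main.v *)
(** An ordered pair partition is read as a word in which every colour occurs
    twice.  A nonempty noncrossing word is uniquely [c u c v] with [u], [v]
    noncrossing on disjoint sets of colours; depths drop by one inside [u].
    Counting the colour sets gives, for [M_n = |ONC^2_{2n}(m)| / n!],
    [M^(m)_{n+1} = sum_{a+b=n} M^(m-1)_a M^(m)_b] if [m >= 2] and
    [M^(1)_{n+1} = sum_{a+b=n} M^(1)_a M^(1)_b / (a+1)]; the latter forces
    [sum_{a+b=n} M^(1)_a M^(1)_b = 2^n].

    Let [L], [L'] be integration against [mu_m], [mu_(m-1)] and [D p] the double
    integral of [(p x - p y) / (x - y)].  The recursions say [L (X p) = D p],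
    respectively [D ((X^2 - 2) p) = 0], for all polynomials [p].  The moments
    grow geometrically, so the measures have bounded support, where [1/(z - x)]
    is a limit of polynomials together with its difference quotients.  Passing
    to the limit gives [z G_m - 1 = G_m G_(m-1)], respectively
    [(z^2 - 2) G_1^2 = 1], on the whole half-plane without analytic
    continuation; the sign of the imaginary part selects the branch. *)

Require Import Defs.
From HB Require Import structures.
From mathcomp Require Import all_boot all_order all_algebra.
From mathcomp Require Import zify.

Set Implicit Arguments. Unset Strict Implicit. Unset Printing Implicit Defensive.

(** * Counting ordered noncrossing pair partitions *)

Section Words.
Variable k : nat.
Implicit Types (w u v : seq 'I_k) (S A B : {set 'I_k}) (a b c i j : 'I_k).

(* For a word in which [i] and [j] occur twice, block [i] is inner w.r.t. block
   [j] iff erasing all other letters leaves [j i i j]. *)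
Definition restrict2 a b w := [seq x <- w | pred2 a b x].
Definition nests w j i := restrict2 j i w == [:: j; i; i; j].
Definition word_depth w i := #|[set j | nests w j i]|.+1.
Definition word_on S w := [forall c, count_mem c w == (c \in S).*2].
Definition crossfree w :=
  [forall a, forall b, (a != b) ==> (restrict2 a b w != [:: a; b; a; b])].
Definition orderly m w :=
  [forall i, forall j, ((m <= word_depth w j) && nests w j i) ==> (j < i)].
Definition onc_word m S w := [&& word_on S w, crossfree w & orderly m w].

Lemma word_onP S w c : word_on S w -> count_mem c w = (c \in S).*2.
Proof. by move/forallP/(_ c)/eqP. Qed.

Lemma word_on_mem S w : word_on S w -> w =i S.
Proof.
move=> wS c; have := word_onP c wS; rewrite -has_pred1 has_count.
by case: (c \in S) => ->.
Qed.

Lemma restrict2C a b w : restrict2 a b w = restrict2 b a w.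
Proof. by apply: eq_filter => x /=; rewrite orbC. Qed.

Lemma mem_restrict2 a b w x : x \in restrict2 a b w -> x \in w.
Proof. by rewrite mem_filter => /andP[]. Qed.

Lemma restrict2_notin a b w :
  b \notin w -> restrict2 a b w = nseq (count_mem a w) a.
Proof.
elim: w => //= x w IH; rewrite inE negb_or => /andP[bx bw].
rewrite /= -/(restrict2 a b w) IH // [x == b]eq_sym (negPf bx) orbF.
by case: eqVneq => [->|].
Qed.

Lemma restrict2_onr S w a b : word_on S w -> b \notin S ->
  restrict2 a b w = nseq (a \in S).*2 a.
Proof.
by move=> wS bS; rewrite restrict2_notin ?(word_on_mem wS) // (word_onP _ wS).
Qed.

Lemma restrict2_onl S w a b : word_on S w -> a \notin S ->
  restrict2 a b w = nseq (b \in S).*2 b.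
Proof. by rewrite restrict2C; apply: restrict2_onr. Qed.

Lemma nests_mem S w j i : word_on S w -> nests w j i -> (j \in S) && (i \in S).
Proof.
move=> wS /eqP e; rewrite -!(word_on_mem wS).
by rewrite !(@mem_restrict2 j i w) // e !inE eqxx ?orbT.
Qed.

(** * Splitting a word at the two occurrences of its first letter *)

Section Split.
Variables (c : 'I_k) (u v : seq 'I_k) (A B : {set 'I_k}).
Hypotheses (cA : c \notin A) (cB : c \notin B) (AB : [disjoint A & B]).
Hypotheses (uA : word_on A u) (vB : word_on B v).
Let w := c :: u ++ c :: v.

Let notinB x : x \in A -> x \notin B.
Proof. by move=> xA; rewrite (disjointFr AB xA). Qed.

Lemma restrict2_split a b : restrict2 a b w =
  nseq ((c == a) || (c == b)) c ++ restrict2 a b u ++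
  nseq ((c == a) || (c == b)) c ++ restrict2 a b v.
Proof.
by rewrite /restrict2 /w /= filter_cat /=; case: (c == a); case: (c == b).
Qed.

(** In [w] the two letters [c] enclose exactly [u]. Since [A] and [B] are disjoint, a letter [x] of
    [u] and a letter [y] of [v] leave [x x y y], which is no nesting. *)
Lemma nests_split j i :
  nests w j i = [|| (j == c) && (i \in A), nests u j i | nests v j i].
Proof.
have nu x y : x \notin A -> nests u x y = false.
  by move=> xA; apply/negP => /(nests_mem uA); rewrite (negPf xA).
have nv x y : x \notin B -> nests v x y = false.
  by move=> xB; apply/negP => /(nests_mem vB); rewrite (negPf xB).
have nu' x y : y \notin A -> nests u x y = false.
  by move=> xA; apply/negP => /(nests_mem uA); rewrite (negPf xA) andbF.
have nv' x y : y \notin B -> nests v x y = false.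
  by move=> xB; apply/negP => /(nests_mem vB); rewrite (negPf xB) andbF.
rewrite {1}/nests restrict2_split.
have [->|jc] := eqVneq j c; rewrite ?eqxx /=.
  rewrite (nu c) // (nv c) // !orbF.
  rewrite (restrict2_onl _ uA) // (restrict2_onl _ vB) //.
  have [iA|iA] := boolP (i \in A).
    by rewrite (negPf (notinB iA)) /= eqxx.
  have [iB|iB] := boolP (i \in B); apply/eqP => // -[e _].
  by move: cB; rewrite e iB.
rewrite /=.
have [->|ic] := eqVneq i c; rewrite ?eqxx /=.
  rewrite nu' // nv' //=; apply/eqP => -[e _].
  by rewrite e eqxx in jc.
have [jA|jA] := boolP (j \in A).
  rewrite (nv j) ?notinB // orbF (restrict2_onl _ vB) ?notinB //.
  have [iB|iB] := boolP (i \in B); last by rewrite cats0.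
  have iA : i \notin A by rewrite (disjointFl AB iB).
  rewrite (nu' j i) // (restrict2_onr _ uA) // jA /=.
  apply/eqP => -[e _]; by rewrite e (negPf iA) in jA.
rewrite (nu j) //= (restrict2_onl _ uA) //.
have [iA|iA] := boolP (i \in A); last by [].
rewrite (nv' j i) ?notinB //=; apply/eqP => -[e _].
by rewrite -e iA in jA.
Qed.

(** Only pairs of letters from different parts need an argument: they leave [c x x c], [c c y y] or
    [x x y y] with [x] in [u] and [y] in [v], and none of these alternates. *)
Lemma crossfree_split : crossfree w = crossfree u && crossfree v.
Proof.
apply/idP/andP => [cw|[cu cv]].
  have h a b : a != b -> restrict2 a b w != [:: a; b; a; b].
    by move: cw => /forallP/(_ a)/forallP/(_ b)/implyP.
  split; apply/forallP => a; apply/forallP => b; apply/implyP => ab.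
    apply/eqP => e.
    have ma : a \in u by apply: (@mem_restrict2 a b); rewrite e inE eqxx.
    have mb : b \in u by apply: (@mem_restrict2 a b); rewrite e !inE eqxx orbT.
    rewrite !(word_on_mem uA) in ma mb.
    have := h a b ab; rewrite restrict2_split e.
    have -> : (c == a) = false by apply: contraNF cA => /eqP ->.
    have -> : (c == b) = false by apply: contraNF cA => /eqP ->.
    by rewrite (restrict2_onl _ vB) ?notinB // (negPf (notinB mb)) /= eqxx.
  apply/eqP => e.
  have ma : a \in v by apply: (@mem_restrict2 a b); rewrite e inE eqxx.
  have mb : b \in v by apply: (@mem_restrict2 a b); rewrite e !inE eqxx orbT.
  rewrite !(word_on_mem vB) in ma mb.
  have := h a b ab; rewrite restrict2_split e.
  have -> : (c == a) = false by apply: contraNF cB => /eqP ->.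
  have -> : (c == b) = false by apply: contraNF cB => /eqP ->.
  by rewrite (restrict2_onl _ uA) ?(disjointFl AB ma) // (disjointFl AB mb) /= eqxx.
apply/forallP => a; apply/forallP => b; apply/implyP => ab.
have hu : restrict2 a b u != [:: a; b; a; b].
  by move: cu => /forallP/(_ a)/forallP/(_ b)/implyP; apply.
have hv : restrict2 a b v != [:: a; b; a; b].
  by move: cv => /forallP/(_ a)/forallP/(_ b)/implyP; apply.
rewrite restrict2_split.
have [ac|ac] := eqVneq c a; rewrite ?eqxx /=.
  subst a; rewrite (restrict2_onl _ uA) // (restrict2_onl _ vB) //.
  have [iA|iA] := boolP (b \in A).
    by rewrite (negPf (notinB iA)) /=; apply/eqP => -[e]; rewrite e eqxx in ab.
  by apply/eqP => -[e]; rewrite e eqxx in ab.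
have [bc|bc] := eqVneq c b; rewrite ?eqxx /=.
  by apply/eqP => -[e]; rewrite e eqxx in ac.
have [aA|aA] := boolP (a \in A).
  rewrite (restrict2_onl _ vB) ?notinB //.
  have [bB|bB] := boolP (b \in B); last by rewrite cats0.
  rewrite (restrict2_onr _ uA) ?(disjointFl AB bB) // aA /=.
  by apply/eqP => -[e]; rewrite e eqxx in ab.
rewrite (restrict2_onl _ uA) //.
have [bA|bA] := boolP (b \in A); last by [].
by rewrite /=; apply/eqP => -[e]; rewrite e eqxx in ab.
Qed.

Lemma word_depth_splitl i : i \in A -> word_depth w i = (word_depth u i).+1.
Proof.
move=> iA; rewrite /word_depth.
have -> : [set j | nests w j i] = c |: [set j | nests u j i].
  apply/setP => j; rewrite !inE nests_split iA andbT.
  case: (boolP (nests v j i)) => [/(nests_mem vB)|]; last by rewrite orbF.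
  by rewrite (negPf (notinB iA)) andbF.
rewrite cardsU1 inE.
case: (boolP (nests u c i)) => [/(nests_mem uA)|] //.
by rewrite (negPf cA).
Qed.

Lemma word_depth_splitr i : i \in B -> word_depth w i = word_depth v i.
Proof.
move=> iB; rewrite /word_depth; congr (#|pred_of_set _|.+1).
have iA : i \in A = false by rewrite (disjointFl AB iB).
apply/setP => j; rewrite !inE nests_split iA andbF /=.
by case: (boolP (nests u j i)) => [/(nests_mem uA)|//]; rewrite iA andbF.
Qed.

Lemma word_depth_split0 : word_depth w c = 1.
Proof.
apply/eqP; rewrite /word_depth eqSS cards_eq0; apply/eqP/setP => j.
rewrite !inE nests_split (negPf cA) andbF /=.
apply/negP => /orP[/(nests_mem uA)|/(nests_mem vB)].
  by rewrite (negPf cA) andbF.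
by rewrite (negPf cB) andbF.
Qed.

(** Being enclosed by [c] raises every depth in [u] by one, which lowers the threshold there to
    [m.-1]; depths in [v] do not change. The letter [c] has depth 1, so its own constraint on [A]
    binds only for [m <= 1]. *)
Lemma orderly_split m : orderly m w =
  [&& orderly m.-1 u, orderly m v & (1 < m) || [forall i in A, c < i]].
Proof.
have H (x : seq 'I_k) n : reflect
  (forall j i, nests x j i -> n <= word_depth x j -> j < i) (orderly n x).
  apply: (iffP forallP) => [h j i ji nj|h i].
    by have /forallP/(_ j)/implyP := h i; rewrite ji nj; apply.
  by apply/forallP => j; apply/implyP => /andP[? ?]; apply: h.
apply/H/and3P => [h|[/H hu /H hv hc] j i].
  split.
  - apply/H => j i ji mj; apply: h; first by rewrite nests_split ji orbT.
    have /andP[jA _] := nests_mem uA ji.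
    by rewrite word_depth_splitl //; case: (m) mj.
  - apply/H => j i ji mj; apply: h; first by rewrite nests_split ji !orbT.
    have /andP[jA _] := nests_mem vB ji.
    by rewrite word_depth_splitr.
  - have [//|m1] := ltnP 1 m.
    apply/forall_inP => i iA; apply: h; first by rewrite nests_split eqxx iA.
    by rewrite word_depth_split0.
rewrite nests_split => /or3P[/andP[/eqP -> iA]|ji|ji].
- rewrite word_depth_split0 => m1; move: hc; rewrite ltnNge m1 /=.
  by move/forall_inP; apply.
- have /andP[jA _] := nests_mem uA ji; rewrite word_depth_splitl // => mj.
  by apply: hu => //; case: (m) mj.
- have /andP[jA _] := nests_mem vB ji; rewrite word_depth_splitr // => mj.
  exact: hv.
Qed.

Lemma word_on_split S : c \in S -> A \subset S :\ c -> B = (S :\ c) :\: A ->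
  word_on S w.
Proof.
move=> cS AS BE; apply/forallP => x; rewrite /w /= count_cat /=.
rewrite (word_onP _ uA) (word_onP _ vB).
have [->|xc] := eqVneq x c; first by rewrite cS (negPf cA) (negPf cB) eqxx.
rewrite !add0n.
have -> : x \in B = (x \in S) && (x \notin A) by rewrite BE !inE xc andbC.
have [xA|xA] := boolP (x \in A); last by rewrite andbT.
by have := subsetP AS x xA; rewrite !inE => /andP[_ ->].
Qed.

End Split.

(** Take for [c] the first letter and cut at its second occurrence. A letter [y] with one occurrence
    on each side of the cut would leave [c y c y], a crossing. *)
Lemma onc_word_decomp m S w : onc_word m S w -> S != set0 ->
  exists c u v A, [/\ c \in S, A \subset S :\ c, w = c :: u ++ c :: v,
     word_on A u & word_on ((S :\ c) :\: A) v].
Proof.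
move=> /and3P[wS cw _] /set0Pn[x xS].
case: w wS cw => [|c w'] wS cw.
  by have := word_onP x wS; rewrite xS.
have cS : c \in S by rewrite -(word_on_mem wS) inE eqxx.
have cw' : c \in w'.
  have := word_onP c wS; rewrite cS /= eqxx add1n => -[e].
  by rewrite -has_pred1 has_count e.
case/splitPr: cw' wS cw => u v wS cw.
have cnt y : count_mem y u + count_mem y v + (c == y).*2 = (y \in S).*2.
  by rewrite -(word_onP y wS) /= count_cat /=; lia.
have cu : c \notin u by rewrite -has_pred1 has_count; have := cnt c; rewrite cS eqxx; lia.
have cv : c \notin v by rewrite -has_pred1 has_count; have := cnt c; rewrite cS eqxx; lia.
have uv y : y \in u -> y \notin v.
  move=> yu; apply/negP => yv.
  have cy : c != y by apply: contraNneq cu => ->.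
  have := cnt y; rewrite (negPf cy) addn0.
  have h1 : 0 < count_mem y u by rewrite -has_count has_pred1.
  have h2 : 0 < count_mem y v by rewrite -has_count has_pred1.
  move=> e; have [e1 e2] : count_mem y u = 1 /\ count_mem y v = 1.
    by move: e h1 h2; move: (count_mem y u) (count_mem y v) => p q; case: (y \in S) => /=; lia.
  move/forallP/(_ c)/forallP/(_ y)/implyP/(_ cy): cw.
  rewrite restrict2_split eqxx /= restrict2C restrict2_notin // e1.
  by rewrite restrict2C restrict2_notin // e2 /= eqxx.
pose A := [set y | y \in u].
exists c, u, v, A; split => //.
- apply/subsetP => y; rewrite !inE => yu.
  rewrite -(word_on_mem wS) !inE mem_cat yu orbT andbT.
  by apply: contraNneq cu => <-.
- apply/forallP => y; rewrite inE; have := cnt y.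
  have [yu|yu] := boolP (y \in u); last by rewrite (count_memPn yu).
  have cy : c != y by apply: contraNneq cu => ->.
  have yS : y \in S by rewrite -(word_on_mem wS) !inE mem_cat yu orbT.
  by rewrite (count_memPn (uv _ yu)) (negPf cy) yS !addn0 => ->.
- apply/forallP => y; rewrite !inE; have := cnt y.
  have [yu|yu] := boolP (y \in u).
    by rewrite (count_memPn (uv _ yu)).
  rewrite (count_memPn yu) add0n.
  have [->|yc] := eqVneq y c; first by rewrite cS (count_memPn cv).
  by rewrite addn0 => ->.
Qed.

Lemma onc_word0 m w : onc_word m set0 w = (w == [::]).
Proof.
apply/idP/eqP => [/and3P[w0 _ _]|->].
  case: w w0 => // x w /(word_onP x); by rewrite inE /= eqxx.
apply/and3P; split.
- by apply/forallP => x; rewrite inE.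
- by apply/forallP => a; apply/forallP => b; apply/implyP.
- by apply/forallP => a; apply/forallP => b; apply/implyP => /andP[].
Qed.

(* The pairs (outer colour, colours inside its block). *)
Definition splittings m S : {set 'I_k * {set 'I_k}} :=
  [set p : 'I_k * {set 'I_k} | [&& p.1 \in S, p.2 \subset S :\ p.1 &
            (1 < m) || [forall i in p.2, p.1 < i]]].

(* [n] is fuel: the enumeration is meaningful only for [#|S| <= n]. *)
Fixpoint onc_words n m S : seq (seq 'I_k) :=
  if n is n'.+1 then
    if S == set0 then [:: [::]] else
    [seq p.1 :: x.1 ++ p.1 :: x.2 | p <- enum (splittings m S),
      x <- [seq (u, v) | u <- onc_words n' m.-1 p.2,
                         v <- onc_words n' m ((S :\ p.1) :\: p.2)]]
  else [:: [::]].

Lemma card_splitl n S c A : #|S| <= n.+1 -> c \in S -> A \subset S :\ c ->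
  #|A| <= n.
Proof.
move=> Sn cS /subset_leq_card; rewrite (cardsD1 c S) cS in Sn.
by move=> h; apply: leq_trans h _.
Qed.

Lemma card_splitr n S c A : #|S| <= n.+1 -> c \in S ->
  #|(S :\ c) :\: A| <= n.
Proof.
move=> Sn cS; rewrite (cardsD1 c S) cS in Sn.
by apply: leq_trans (subset_leq_card (subsetDl _ _)) _.
Qed.

Lemma disjoint_setD S A : [disjoint A & S :\: A].
Proof. by rewrite disjoints_subset setCD subsetUr. Qed.

Lemma mem_onc_words n m S w : #|S| <= n -> (w \in onc_words n m S) = onc_word m S w.
Proof.
elim: n m S w => [|n IH] m S w Sn /=.
  move: Sn; rewrite leqn0 cards_eq0 => /eqP ->.
  by rewrite onc_word0 inE.
have [->|S0] := eqVneq S set0; first by rewrite onc_word0 inE.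
have key c u v A : c \in S -> A \subset S :\ c -> word_on A u -> word_on ((S :\ c) :\: A) v ->
    onc_word m S (c :: u ++ c :: v) =
    [&& onc_word m.-1 A u, onc_word m ((S :\ c) :\: A) v &
      (1 < m) || [forall i in A, c < i]].
  move=> cS AS uA vB.
  have cA : c \notin A.
    by apply/negP => /(subsetP AS); rewrite !inE eqxx.
  have cB : c \notin (S :\ c) :\: A by rewrite !inE eqxx andbF.
  have dAB := disjoint_setD (S :\ c) A.
  rewrite /onc_word (word_on_split cA cB uA vB) // uA vB.
  rewrite (crossfree_split cA cB dAB uA vB) (orderly_split cA cB dAB uA vB) /=.
  by rewrite -!andbA; do !bool_congr.
apply/allpairsPdep/idP => [[[c A] [x [/= ]]]|ow].
  rewrite mem_enum inE /= => /and3P[cS AS cond] /allpairsP[[u v] [/= hu hv ->]] ->.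
  rewrite IH ?(card_splitl Sn cS AS) // in hu.
  rewrite IH ?(card_splitr _ Sn cS) // in hv.
  have /andP[uA _] := hu; have /andP[vB _] := hv.
  by rewrite (key c u v A) //= hu hv cond.
have [c [u [v [A [cS AS we uA vB]]]]] := onc_word_decomp ow S0.
move: ow; rewrite we (key c u v A) // => /and3P[hu hv cond].
exists (c, A), (u, v); split => //=.
  by rewrite mem_enum inE /= cS AS cond.
apply/allpairsP; exists (u, v); split => //=.
  by rewrite IH ?(card_splitl Sn cS AS).
by rewrite IH ?(card_splitr _ Sn cS).
Qed.

(** All the data can be read off a word: [c] is its head, [u] ends just before the next [c], [A] is
    the set of letters of [u], and [v] is the rest. *)
Lemma uniq_onc_words n m S : #|S| <= n -> uniq (onc_words n m S).
Proof.
elim: n m S => [//|n IH] m S Sn /=.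
case: eqP => // _; apply: allpairs_uniq_dep.
- exact: enum_uniq.
- move=> [c A]; rewrite mem_enum inE /= => /and3P[cS AS _].
  apply: allpairs_uniq => //.
  + by apply: IH; rewrite (card_splitl Sn cS AS).
  + by apply: IH; rewrite (card_splitr _ Sn cS).
  + by move=> [? ?] [? ?] _ _ [-> ->].
move=> _ _ /allpairsPdep[[c A] [x [hp hx ->]]] /allpairsPdep[[c' A'] [x' [hp' hx' ->]]] /=.
move: hp hp' hx hx'; rewrite !mem_enum !inE /= => /and3P[cS AS _] /and3P[cS' AS' _].
move=> /allpairsP[[u v] [/= hu hv ->]] /allpairsP[[u' v'] [/= hu' hv' ->]] [ec].
subst c'.
rewrite !mem_onc_words ?(card_splitl Sn cS AS) ?(card_splitl Sn cS' AS')
  ?(card_splitr _ Sn cS) // in hu hu' hv hv'.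
have /andP[uA _] := hu; have /andP[uA' _] := hu'.
have cu (X : {set 'I_k}) (y : seq 'I_k) : X \subset S :\ c -> word_on X y -> c \notin y.
  move=> XS yX; rewrite (word_on_mem yX).
  by apply/negP => /(subsetP XS); rewrite !inE eqxx.
move=> e.
have eu : u = u'.
  have ix (y z : seq 'I_k) : c \notin y -> take (index c (y ++ c :: z)) (y ++ c :: z) = y.
    move=> cy; rewrite index_cat (negPf cy) /= eqxx addn0 take_size_cat //.
  by rewrite -(ix u v) ?(cu _ _ AS uA) // e ix ?(cu _ _ AS' uA').
subst u'; have eA : A = A' by apply/setP => y; rewrite -(word_on_mem uA) -(word_on_mem uA').
by move/eqP: e; rewrite eqseq_cat // => /andP[_ /eqP[->]]; rewrite eA.
Qed.

End Words.

(** * The recursion for the number of words *)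

Definition split_count m s a := if 1 < m then s * 'C(s.-1, a) else 'C(s, a.+1).

Fixpoint onc_count n m s : nat :=
  if n is n'.+1 then if s is s'.+1 then
    \sum_(a < s) split_count m s a * (onc_count n' m.-1 a * onc_count n' m (s' - a))
  else 1 else 1.

Section Counting.
Variable k : nat.
Implicit Types (S A : {set 'I_k}).

(** For [1 < m] the colour [c] is free and [A] is any [a]-subset of the others. For [m <= 1] the
    colour [c] must lie below all of [A], so [(c, A)] amounts to an arbitrary [a.+1]-subset of [S]
    with [c] as its minimum. *)
Lemma card_splittings m S a :
  #|[set p in splittings m S | #|p.2| == a]| = split_count m #|S| a.
Proof.
rewrite /split_count; case: ltnP => m1.
  rewrite -sum1_card.
  transitivity (\sum_(c in S) \sum_(A : {set 'I_k} | (A \subset S :\ c) && (#|A| == a)) 1).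
    rewrite pair_big_dep; apply: eq_bigl => -[c A]; rewrite !inE /= m1 andbT.
    by rewrite andbA.
  rewrite -sum_nat_const; apply: eq_bigr => c cS.
  rewrite (cardsD1 c S) cS /= -cards_draws -sum1_card.
  by apply: eq_bigl => A; rewrite inE.
set X := [set p in _ | _].
have XP (p : 'I_k * {set 'I_k}) : p \in X ->
   [/\ p.1 \in S, p.2 \subset S :\ p.1, forall i, i \in p.2 -> p.1 < i & #|p.2| = a].
  rewrite !inE => /andP[/and3P[h1 h2 h3] /eqP h4]; split => //.
  by move: h3; rewrite ltnNge m1 /= => /forall_inP.
pose g (p : 'I_k * {set 'I_k}) := p.1 |: p.2.
have notin (p : 'I_k * {set 'I_k}) : p \in X -> p.1 \notin p.2.
  by move=> /XP[_ h _ _]; apply/negP => /(subsetP h); rewrite !inE eqxx.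
have ginj : {in X &, injective g}.
  move=> [c A] [c' A'] cX cX' /= e.
  have [_ _ l _] := XP _ cX; have [_ _ l' _] := XP _ cX'.
  have nA := notin _ cX; have nA' := notin _ cX'.
  rewrite /g /= in l l' e nA nA'.
  have ec : c = c'.
    apply/eqP; rewrite -val_eqE /= eqn_leq; apply/andP; split.
      have : c' \in c |: A by rewrite e !inE eqxx.
      by rewrite !inE => /orP[/eqP -> //|/l /ltnW].
    have : c \in c' |: A' by rewrite -e !inE eqxx.
    by rewrite !inE => /orP[/eqP -> //|/l' /ltnW].
  by subst c'; rewrite -(setU1K nA) -(setU1K nA') e.
rewrite -(card_in_imset ginj) -cards_draws; congr #|pred_of_set _|.
apply/setP => B; rewrite inE; apply/imsetP/andP => [[p pX ->]|[BS /eqP cB]].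
  have [h1 h2 _ h4] := XP _ pX; rewrite /g cardsU1 (notin _ pX) h4; split => //.
  by rewrite subUset sub1set h1 (subset_trans h2) ?subD1set.
have [x xB] : exists x, x \in B by apply/card_gt0P; rewrite cB.
case: (arg_minnP (fun i : 'I_k => val i) xB) => c cinB cmin; have cB' : c \in B by [].
exists (c, B :\ c); last by rewrite /g /= setD1K.
rewrite !inE /= ltnNge m1 /=; apply/andP; split.
  rewrite (subsetP BS) // setSD //=; apply/forall_inP => i.
  rewrite !inE => /andP[ic iB]; rewrite ltn_neqAle.
  by rewrite [_ <= _]cmin // andbT; apply: contraNneq ic => e; apply/eqP/val_inj.
by move: cB; rewrite (cardsD1 c B) cB' add1n => -[->].
Qed.

Lemma size_onc_words n m S : #|S| <= n ->
  size (onc_words n m S) = onc_count n m #|S|.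
Proof.
elim: n m S => [//|n IH] m S Sn /=.
have [->|S0] := eqVneq S set0; first by rewrite cards0.
rewrite size_allpairs_dep sumnE big_map big_enum /=.
case sE : #|S| => [|s]; first by move/eqP: sE; rewrite cards_eq0 (negPf S0).
pose F a := onc_count n m.-1 a * onc_count n m (s - a).
transitivity (\sum_(p in splittings m S) F #|p.2|).
  apply: eq_bigr => -[c A]; rewrite inE /= => /and3P[cS AS _].
  rewrite size_allpairs IH ?(card_splitl Sn cS AS) // IH ?(card_splitr _ Sn cS) //.
  have -> : #|S :\ c :\: A| = s - #|A|.
    by rewrite cardsDS //; move: sE; rewrite (cardsD1 c) cS add1n => -[->].
  by [].
(* Group the splittings by the size of [A]. That size is at most [s], because [A] avoids [c], so
   [inord] does not fall back to its default. *)
rewrite (partition_big (fun p : 'I_k * {set 'I_k} => inord #|p.2| : 'I_s.+1) predT) //=.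
apply: eq_bigr => a _.
rewrite -(congr1 (fun t => split_count m t a) sE) -card_splittings -sum_nat_const.
have lt (p : 'I_k * {set 'I_k}) : p \in splittings m S -> #|p.2| < s.+1.
  rewrite inE => /and3P[cS /subset_leq_card AS _]; apply: leq_trans AS _.
  by move: sE; rewrite (cardsD1 p.1) cS add1n => -[->].
have eqa (p : 'I_k * {set 'I_k}) : (p \in splittings m S) && (inord #|p.2| == a) =
    (p \in [set p in splittings m S | #|p.2| == a]).
  rewrite [in RHS]inE; case: (boolP (p \in _)) => //= /lt pl.
  by rewrite -val_eqE /= inordK.
rewrite (eq_bigl _ _ eqa); apply: eq_bigr => p; rewrite inE => /andP[_ /eqP ->].
by [].
Qed.

End Counting.

Lemma onc_count_fuel n n' m s : s <= n -> s <= n' ->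
  onc_count n m s = onc_count n' m s.
Proof.
elim: n n' m s => [|n IH] [|n'] m [|s] //= sn sn'.
apply: eq_bigr => -[a /= asl] _; congr (_ * (_ * _)); apply: IH; lia.
Qed.

Definition onc_num m s := onc_count s m s.

Lemma onc_num0 m : onc_num m 0 = 1. Proof. by []. Qed.

Lemma onc_numS m s : onc_num m s.+1 =
  \sum_(a < s.+1) split_count m s.+1 a * (onc_num m.-1 a * onc_num m (s - a)).
Proof.
rewrite {1}/onc_num /=; apply: eq_bigr => -[a /= asl] _; congr (_ * (_ * _)).
  by apply: onc_count_fuel; lia.
by apply: onc_count_fuel; lia.
Qed.

(** * The word of an ordered pair partition *)

Section PartitionWord.
Variables (n k : nat) (f : {ffun 'I_n -> 'I_k}).
Implicit Types (a b i j : 'I_k).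

Definition partition_word := [seq f s | s <- enum 'I_n].
Let w := partition_word.

Definition positions2 a b := [seq s <- enum 'I_n | pred2 a b (f s)].

Lemma restrict2_partition_word a b : restrict2 a b w = map f (positions2 a b).
Proof. by rewrite /restrict2 filter_map. Qed.

Lemma count_partition_word a : count_mem a w = #|block f a|.
Proof.
rewrite count_map -sum1_card -sum1_count big_enum_cond.
by apply: eq_bigl => s /=; rewrite inE.
Qed.

Lemma positions2_sorted a b : sorted (fun s t : 'I_n => s < t) (positions2 a b).
Proof.
apply: sorted_filter; first by move=> x y z; apply: ltn_trans.
have := iota_ltn_sorted 0 n; rewrite -val_enum_ord sorted_map.
by apply: sub_sorted.
Qed.

Lemma mem_positions2 a b s : (s \in positions2 a b) = (f s == a) || (f s == b).
Proof. by rewrite mem_filter mem_enum andbT. Qed.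

Hypothesis pf : pair_blocks f.

Lemma card_block a : #|block f a| = 2.
Proof. by apply/eqP; move/forallP: pf. Qed.

Lemma size_positions2 a b : a != b -> size (positions2 a b) = 4.
Proof.
move=> ab; rewrite -(size_map f) -restrict2_partition_word /restrict2 size_filter.
have -> : count (pred2 a b) w = count_mem a w + count_mem b w.
  rewrite -count_predUI [X in _ + X](_ : _ = 0) ?addn0 //.
  rewrite -(count_pred0 w); apply: eq_count => x /=.
  by apply/negP => /andP[/eqP -> /eqP e]; rewrite e eqxx in ab.
by rewrite !count_partition_word !card_block.
Qed.

(** Two blocks of size two occupy only four positions, so any four increasing positions with these
    colours exhaust them. *)
Lemma positions2_eq a b (l : seq 'I_n) : a != b -> size l = 4 ->
  sorted (fun s t : 'I_n => s < t) l ->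
  all (fun s => pred2 a b (f s)) l -> positions2 a b = l.
Proof.
move=> ab l4 sl al.
have tr : transitive (fun s t : 'I_n => s < t) by move=> x y z; apply: ltn_trans.
have ir : irreflexive (fun s t : 'I_n => s < t) by move=> x; apply: ltnn.
have ul : uniq l by apply: sorted_uniq sl.
apply: (irr_sorted_eq tr ir) => //; first exact: positions2_sorted.
have lp : {subset l <= positions2 a b}.
  by move=> x /(allP al); rewrite mem_positions2.
have [|_ e x] := uniq_min_size ul lp; last by rewrite e.
by rewrite size_positions2 ?l4.
Qed.

Lemma word_on_partition_word : word_on setT w.
Proof.
by apply/forallP => a; rewrite count_partition_word card_block inE.
Qed.

Lemma crossfree_partition_word : crossfree w = noncrossing f.
Proof.
apply/idP/idP => h.
  apply/forallP => s; apply/forallP => r; apply/forallP => s'; apply/forallP => r'.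
  apply/negP => /and5P[sr rs sr' /eqP e1 /andP[/eqP e2 e3]].
  have := h => /forallP/(_ (f s))/forallP/(_ (f r))/implyP/(_ e3)/eqP; apply.
  rewrite restrict2_partition_word (@positions2_eq _ _ [:: s; r; s'; r']) //=.
  - by rewrite -e1 -e2.
  - by rewrite sr rs sr'.
  - by rewrite -e1 -e2 !eqxx ?orbT.
apply/forallP => a; apply/forallP => b; apply/implyP => ab; apply/eqP.
rewrite restrict2_partition_word; have := positions2_sorted a b.
case: (positions2 a b) => [|s [|r [|s' [|r' [|]]]]] //= so [e1 e2 e3 e4].
move/forallP/(_ s)/forallP/(_ r)/forallP/(_ s')/forallP/(_ r'): h.
by rewrite e1 e2 e3 e4 !eqxx ab /= !andbT; move: so; rewrite andbT => ->.
Qed.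

(** In a block of size two, the consecutive elements [p < q] required by [inner] are the whole
    block, so being inner is a condition on the order of four positions. *)
Lemma nests_partition_word j i : nests w j i = inner f j i.
Proof.
rewrite /nests restrict2_partition_word; apply/eqP/idP => [|].
  have [->|ji] := eqVneq j i.
    move/(congr1 size); rewrite -restrict2_partition_word /restrict2 size_filter.
    rewrite (eq_count (a2 := pred1 i)) => [|x /=]; last by rewrite orbb.
    by rewrite count_partition_word card_block.
  have := positions2_sorted j i; have := mem_positions2 j i.
  case: (positions2 j i) => [|p [|s [|s' [|q [|]]]]] //= me so [e1 e2 e3 e4].
  have [ps ss sq] : [/\ p < s, s < s' & s' < q] by move: so; rewrite andbT => /and3P[].
  apply/existsP; exists p; apply/existsP; exists q.
  rewrite !inE e1 e4 eqxx (ltn_trans ps) ?(ltn_trans ss) //=.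
  apply/andP; split; apply/forallP => t; apply/implyP; rewrite inE => /eqP ft.
    have : t \in [:: p; s; s'; q] by rewrite me ft eqxx.
    rewrite !inE => /or4P[] /eqP tE; rewrite tE ?ltnn ?andbF //.
      by rewrite tE e2 in ft; rewrite ft eqxx in ji.
    by rewrite tE e3 in ft; rewrite ft eqxx in ji.
  have : t \in [:: p; s; s'; q] by rewrite me ft eqxx orbT.
  rewrite !inE => /or4P[] /eqP tE; move: ft; rewrite tE ?e1 ?e4 => ft.
  - by rewrite ft eqxx in ji.
  - by rewrite ps (ltn_trans ss).
  - by rewrite sq (ltn_trans ps).
  - by rewrite ft eqxx in ji.
case/existsP => p /existsP[q /and5P[pj qj pq _ /forallP hi]].
have ji : j != i.
  apply/eqP => e; have := hi p; rewrite -e pj /= ltnn //.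
have [x [y [xy bi]]] : exists x y, x != y /\ block f i = [set x; y].
  by apply/cards2P; rewrite card_block.
have h t : t \in block f i -> (p < t) && (t < q) by apply: (implyP (hi t)).
wlog {xy} xy : x y bi / x < y.
  move=> H; have : (x < y) || (y < x).
    by move: xy; rewrite -val_eqE /= neq_ltn.
  by case/orP => l; [apply: (H x y)|apply: (H y x); rewrite // setUC].
have xi : x \in block f i by rewrite bi !inE eqxx.
have yi : y \in block f i by rewrite bi !inE eqxx orbT.
have /andP[px xq] := h x xi; have /andP[py yq] := h y yi.
rewrite !inE in pj qj xi yi; move: pj qj xi yi => /eqP pj /eqP qj /eqP xi /eqP yi.
rewrite (@positions2_eq _ _ [:: p; x; y; q]) //=; first by rewrite pj qj xi yi.
  by rewrite px xy yq.
by rewrite pj qj xi yi !eqxx ?orbT.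
Qed.

Lemma onc_word_partition_word m : onc_word m setT w = is_ONC m f.
Proof.
rewrite /onc_word /is_ONC word_on_partition_word crossfree_partition_word.
have -> : ordered_partition f.
  apply/forallP => r; apply/existsP; apply/card_gt0P.
  by rewrite card_block.
rewrite /orderly /=; congr (_ && _); apply: eq_forallb => i; apply: eq_forallb => j.
have -> : word_depth w j = depth f j.
  by congr (_.+1); apply: eq_card => x; rewrite !inE nests_partition_word.
by rewrite nests_partition_word.
Qed.

End PartitionWord.

Lemma size_word_on k (S : {set 'I_k}) w : word_on S w -> size w = #|S|.*2.
Proof.
move=> wS; have -> : size w = \sum_c count_mem c w.
  elim: w {wS} => [|x w IH] /=; first by rewrite big1.
  rewrite big_split /= -IH (bigD1 x) //= eqxx big1 ?addn0 // => c.
  by rewrite eq_sym => /negPf ->.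
rewrite -muln2 -sum1_card big_distrl /= [RHS]big_mkcond /=.
by apply: eq_bigr => c _; rewrite (word_onP _ wS); case: (c \in S).
Qed.

(** [partition_word] is injective, and its inverse reads the letters of a word as the colours of the
    positions; its image is the duplicate-free list [onc_words]. *)
Lemma card_ONC2 m k : #|ONC2 m k| = onc_num m k.
Proof.
have card_T : #|[set: 'I_k]| = k by rewrite cardsT card_ord.
rewrite /onc_num -[X in onc_count _ _ X]card_T -size_onc_words ?card_T //.
rewrite cardE -(size_map (@partition_word _ _)); apply: perm_size.
apply: uniq_perm; last first.
- move=> w; rewrite mem_onc_words ?card_T //; apply/mapP/idP => [[f]|ow].
    rewrite mem_enum inE => /andP[h pf] ->.
    by rewrite onc_word_partition_word.
  have /andP[wS _] := ow.
  have sz : size w == k.*2 by rewrite (size_word_on wS) card_T.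
  pose f := [ffun s => tnth (Tuple sz) s].
  have we : w = partition_word f.
    rewrite /partition_word -[LHS](map_tnth_enum (Tuple sz)).
    by apply: eq_map => s; rewrite ffunE.
  have pf : pair_blocks f.
    apply/forallP => r; rewrite -count_partition_word -we (word_onP _ wS) inE //.
  exists f => //; rewrite mem_enum inE pf andbT.
  by rewrite -onc_word_partition_word // -we.
- by apply: uniq_onc_words; rewrite card_T.
- rewrite map_inj_uniq ?enum_uniq // => f g e; apply/ffunP => s.
  have /eq_in_map := e; apply; exact: mem_enum.
Qed.

(** * Moment recursions *)

From mathcomp Require Import all_classical all_reals all_analysis.
From mathcomp Require Import measurable_realfun complex ring lra.
Import Order.TTheory GRing.Theory Num.Theory numFieldNormedType.Exports.
Local Open Scope ring_scope.

Section Moments.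
Variable R : realType.
Implicit Types (m n a : nat).

Definition onc_ratio m n : R := (onc_num m n)%:R / n`!%:R.

Lemma factr_neq0 n : n`!%:R != 0 :> R.
Proof. by rewrite pnatr_eq0 -lt0n fact_gt0. Qed.

Lemma onc_ratio0 m : onc_ratio m 0 = 1.
Proof. by rewrite /onc_ratio onc_num0 fact0 divr1. Qed.

Lemma onc_ratio_ge0 m n : 0 <= onc_ratio m n.
Proof. by rewrite divr_ge0 ?ler0n. Qed.

(** The factorials absorb the choice of colours: [(n+1) C(n,a) / (n+1)! = 1 / (a! (n-a)!)]. *)
Lemma onc_ratioS m n : (1 < m)%N -> onc_ratio m n.+1 =
  \sum_(a < n.+1) onc_ratio m (n - a) * onc_ratio m.-1 a.
Proof.
move=> m1; rewrite /onc_ratio onc_numS natr_sum mulr_suml.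
apply: eq_bigr => -[a /= an] _; rewrite /split_count m1 /=.
have an' : (a <= n)%N by rewrite -ltnS.
rewrite factS -(bin_fact an') !natrM.
have h1 : 'C(n, a)%:R != 0 :> R by rewrite pnatr_eq0 -lt0n bin_gt0.
have h2 := factr_neq0 a; have h3 := factr_neq0 (n - a).
have h4 : n.+1%:R != 0 :> R by rewrite pnatr_eq0.
move: 'C(n, a)%:R a`!%:R (n - a)`!%:R n.+1%:R h1 h2 h3 h4 => x1 x2 x3 x4 h1 h2 h3 h4.
by field; rewrite h1 h2 h3 h4.
Qed.

(** Thresholds 0 and 1 have the same [split_count] and the same predecessor 0. This closes the
    recursion for [m = 1] on itself. *)
Lemma onc_num01 n : onc_num 0 n = onc_num 1 n.
Proof.
(* The fuel is separated from the number of colours, so that the induction hypothesis covers all the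
   smaller counts. *)
rewrite /onc_num; move: {1 3}n => s; elim: s n => [//|s IH] [//|n] /=.
by apply: eq_bigr => a _; rewrite !IH.
Qed.

(** Here [C(n+1,a+1) / (n+1)! = 1 / ((a+1)! (n-a)!)], which leaves the factor [1 / (a+1)]. *)
Lemma onc_ratio1S n : onc_ratio 1 n.+1 =
  \sum_(a < n.+1) onc_ratio 1 a / a.+1%:R * onc_ratio 1 (n - a).
Proof.
rewrite /onc_ratio onc_numS natr_sum mulr_suml.
apply: eq_bigr => -[a /= an] _; rewrite /split_count /= onc_num01.
have an' : (a.+1 <= n.+1)%N by rewrite ltnS -ltnS.
rewrite -(bin_fact an') subSS factS !natrM.
have h1 : 'C(n.+1, a.+1)%:R != 0 :> R by rewrite pnatr_eq0 -lt0n bin_gt0.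
have h2 := factr_neq0 a; have h3 := factr_neq0 (n - a).
have h4 : a.+1%:R != 0 :> R by rewrite pnatr_eq0.
move: 'C(n.+1, a.+1)%:R a`!%:R (n - a)`!%:R a.+1%:R h1 h2 h3 h4 => x1 x2 x3 x4 h1 h2 h3 h4.
by field; rewrite h1 h2 h3 h4.
Qed.

(** In closed form [C(2n,n) / 2^n], the even moments of the arcsine law on [[-sqrt 2, sqrt 2]]. *)
Fixpoint arcsine_moment n : R :=
  if n is n'.+1 then n'.*2.+1%:R / n'.+1%:R * arcsine_moment n' else 1.
Notation v := arcsine_moment.

Lemma arcsine_momentS n : n.+1%:R * v n.+1 = n.*2.+1%:R * v n.
Proof. by rewrite /= mulrA mulrCA mulfV ?mulr1 // pnatr_eq0. Qed.

(** The generating function of [v] is [(1 - 2x)^(-1/2)], whose square is [1 / (1 - 2x)]. The proof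
    works on coefficients, by induction from [(a+1) v_(a+1) = (2a+1) v_a]. *)
Lemma arcsine_conv n : \sum_(a < n.+1) v a * v (n - a) = 2 ^+ n.
Proof.
(* By the symmetry [a <-> p - a], the weight [2a] averages to [p]. *)
have sym p : \sum_(a < p.+1) a.*2%:R * (v a * v (p - a)) = p%:R * \sum_(a < p.+1) v a * v (p - a).
  have e : \sum_(a < p.+1) a%:R * (v a * v (p - a)) = \sum_(a < p.+1) (p - a)%:R * (v a * v (p - a)).
    rewrite (reindex_inj rev_ord_inj) /=; apply: eq_bigr => a _.
    by rewrite subSS subKn ?[v (p - a) * _]mulrC // -ltnS.
  transitivity (\sum_(a < p.+1) a%:R * (v a * v (p - a)) + \sum_(a < p.+1) (p - a)%:R * (v a * v (p - a))).
    by rewrite -e -big_split; apply: eq_bigr => a _; rewrite -addnn natrD mulrDl.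
  rewrite -big_split mulr_sumr; apply: eq_bigr => a _ /=.
  by rewrite -mulrDl -natrD subnKC // -ltnS.
elim: n => [|n IH]; first by rewrite big_ord1 mulr1.
have n0 : n.+1%:R != 0 :> R by rewrite pnatr_eq0.
apply: (mulfI n0); rewrite -sym big_ord_recl mul0r add0r.
rewrite exprS mulrCA -IH.
transitivity (\sum_(a < n.+1) (2 * (a.*2%:R * (v a * v (n - a))) + 2 * (v a * v (n - a)))).
  apply: eq_bigr => a _; rewrite lift0 subSS -mul2n natrM -[LHS]mulrA.
  rewrite [a.+1%:R * _]mulrA arcsine_momentS -natr1; ring.
rewrite big_split /= -!mulr_sumr sym -natr1; ring.
Qed.

(* Uses [v_a / (a + 1) = 2 v_a - v_(a+1)] to turn the recursion into two
   instances of [arcsine_conv]. *)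
Lemma onc_ratio1 n : onc_ratio 1 n = v n.
Proof.
elim/ltn_ind: n => -[|n] IH; first by rewrite onc_ratio0.
rewrite onc_ratio1S.
transitivity (\sum_(a < n.+1) (2 * (v a * v (n - a)) - v a.+1 * v (n - a))).
  apply: eq_bigr => -[a /= an] _; rewrite !IH //; last by rewrite ltnS leq_subr.
  have h4 : a.+1%:R != 0 :> R by rewrite pnatr_eq0.
  rewrite -mul2n; move: h4; rewrite -[a.+1%:R]natr1 -[(2 * a).+1%:R]natr1 natrM => h4.
  by field.
rewrite sumrB -mulr_sumr arcsine_conv -exprS -arcsine_conv big_ord_recl subn0 mul1r.
by rewrite addrK.
Qed.

Lemma arcsine_moment_le n : 0 <= v n <= 2 ^+ n.
Proof.
elim: n => [|n /andP[h0 h1]]; first by rewrite /= ler01 lexx.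
have c2 : n.*2.+1%:R / n.+1%:R <= 2 :> R.
  by rewrite ler_pdivrMr ?ltr0Sn // -natrM ler_nat; lia.
have c0 : 0 <= n.*2.+1%:R / n.+1%:R :> R by rewrite divr_ge0.
by rewrite [v n.+1]/= mulr_ge0 //= exprS ler_pM.
Qed.

(** Raising the base by one with each [m] keeps the induction going: [sum_a (m+3)^(n-a) (m+2)^a]
    telescopes to [(m+3)^(n+1) - (m+2)^(n+1)], since the bases differ by 1. *)
Lemma onc_ratio_le m n : onc_ratio m.+1 n <= m.+2%:R ^+ n.
Proof.
elim: m n => [|m IH] n.
  by rewrite onc_ratio1; have /andP[] := arcsine_moment_le n.
elim/ltn_ind: n => -[|n] IHn; first by rewrite onc_ratio0.
rewrite onc_ratioS //.
apply: (@le_trans _ _ (\sum_(a < n.+1) m.+3%:R ^+ (n - a) * m.+2%:R ^+ a)).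
  apply: ler_sum => -[a /= an] _; apply: ler_pM; rewrite ?onc_ratio_ge0 //.
  by apply: IHn; rewrite ltnS leq_subr.
have := subrXX (m.+3%:R : R) m.+2%:R n.+1.
have -> : m.+3%:R - m.+2%:R = 1 :> R by rewrite -[m.+3%:R]natr1 addrAC subrr add0r.
rewrite mul1r /= => <-.
by rewrite gerBl exprn_ge0.
Qed.

Definition interleave0 (x : nat -> R) p := if odd p then 0 else x p./2.

Lemma sum_interleave0 (F : nat -> R) n :
  \sum_(j < n.*2.+1) interleave0 F j = \sum_(a < n.+1) F a.
Proof.
elim: n => [|n IH]; first by rewrite !big_ord1.
rewrite doubleS big_ord_recr [in LHS]big_ord_recr /= IH [RHS]big_ord_recr /=.
by rewrite /interleave0 /= odd_double /= addr0 doubleK.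
Qed.

(** If [i] is odd, then one of [j] and [i - j] is odd and every term vanishes; if [i] is even, only
    even [j] contribute. *)
Lemma interleave0_conv (x y : nat -> R) i :
  \sum_(j < i.+1) interleave0 x (i - j) * interleave0 y j =
  interleave0 (fun n => \sum_(a < n.+1) x (n - a)%N * y a) i.
Proof.
rewrite {3}/interleave0; case: ifP => oi.
  apply: big1 => -[j /= ji] _; rewrite /interleave0 oddB // oi.
  by case: (odd j); rewrite /= ?mulr0 ?mul0r.
have -> : i = i./2.*2 by rewrite -[LHS]odd_double_half oi.
move: (i./2) => n; rewrite doubleK.
rewrite -(@sum_interleave0 (fun a => x (n - a)%N * y a)).
apply: eq_bigr => -[j /= jn] _; rewrite /interleave0 oddB // odd_double /=.
case: ifP => oj; first by rewrite mulr0.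
have -> : j = j./2.*2 by rewrite -[LHS]odd_double_half oj.
by rewrite -doubleB !doubleK.
Qed.

Lemma mmon_momentE m p : mmon_moment R m p = interleave0 (onc_ratio m) p.
Proof. by rewrite /mmon_moment /interleave0 card_ONC2. Qed.

Lemma mmon_moment_rec m i : (1 < m)%N -> mmon_moment R m i.+1 =
  \sum_(j < i) mmon_moment R m (i.-1 - j) * mmon_moment R m.-1 j.
Proof.
move=> m1; case: i => [|i]; first by rewrite big_ord0.
rewrite [LHS]mmon_momentE; under eq_bigr do rewrite !mmon_momentE.
rewrite interleave0_conv /interleave0 /= negbK; case: ifP => // _.
by rewrite -onc_ratioS.
Qed.

(** This is [arcsine_conv] in the index convention of divided differences, where the [i]-th term
    belongs to [(x^i - y^i) / (x - y)]. *)
Lemma mmon_moment1_conv i :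
  \sum_(j < i) mmon_moment R 1 (i.-1 - j) * mmon_moment R 1 j =
  if odd i then 2 ^+ i./2 else 0.
Proof.
case: i => [|i]; first by rewrite big_ord0.
under eq_bigr do rewrite !mmon_momentE.
rewrite interleave0_conv /interleave0 /=; case: ifP => // oi.
rewrite uphalfE -arcsine_conv; under eq_bigr do rewrite !onc_ratio1 mulrC.
by rewrite -[i.+1./2]uphalfE uphalf_half oi.
Qed.

Lemma mmon_moment_even_le m n : mmon_moment R m.+1 n.*2 <= m.+2%:R ^+ n.
Proof. by rewrite mmon_momentE /interleave0 odd_double doubleK onc_ratio_le. Qed.

End Moments.

(** * Linear functionals on polynomials *)

Section MomentFunctionals.
Variable R : realType.
Local Notation C := R[i].
Local Notation nc := (@Normc.normc R).
Implicit Types (p q e : {poly C}) (m n d : nat -> C) (y z : C) (K : R).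

Lemma normc_ge0 z : 0 <= nc z.
Proof. by case: z => a b; apply: sqrtr_ge0. Qed.

Lemma normc_leD z y : nc (z + y) <= nc z + nc y.
Proof. exact: le_normcD. Qed.

Lemma normc_opp z : nc (- z) = nc z.
Proof. exact: normcN. Qed.

Lemma normc_leB z y : nc (z - y) <= nc z + nc y.
Proof. by rewrite -(normc_opp y); apply: normc_leD. Qed.

Lemma normcX z k : nc (z ^+ k) = nc z ^+ k.
Proof.
elim: k => [|k IH]; first by rewrite !expr0 Normc.normc1.
by rewrite !exprS Normc.normcM IH.
Qed.

Lemma normc_real (x : R) : nc x%:C%C = `|x|.
Proof. by rewrite /= expr0n addr0 sqrtr_sqr. Qed.

Lemma normc_Re z : `|complex.Re z| <= nc z.
Proof. by case: z => a b /=; rewrite -sqrtr_sqr ler_wsqrtr // lerDl sqr_ge0. Qed.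

Lemma normc_Im z : `|complex.Im z| <= nc z.
Proof. by case: z => a b /=; rewrite -sqrtr_sqr ler_wsqrtr // lerDr sqr_ge0. Qed.

Lemma normc_le_ReIm z : nc z <= `|complex.Re z| + `|complex.Im z|.
Proof.
rewrite {1}[z]complexE; apply: le_trans (normc_leD _ _) _.
rewrite Normc.normcM !normc_real /= expr0n expr1n add0r sqrtr1 mul1r //.
Qed.

Lemma normc_subr_ge z (x : R) : complex.Im z <= nc (z - x%:C%C).
Proof.
by apply: le_trans (ler_norm _) (le_trans _ (normc_Im _)); case: z => a b /=; rewrite subr0.
Qed.

Lemma normc_small_eq0 z (M : R) :
  (forall eps : R, 0 < eps -> eps <= 1 -> nc z <= M * eps) -> z = 0.
Proof.
move=> h; apply: Normc.eq0_normc; apply/eqP; rewrite eq_le normc_ge0 andbT.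
apply/ler_addgt0Pr => eps e0; rewrite add0r.
have M0 : 0 <= M by rewrite -[M]mulr1 (le_trans (normc_ge0 z)) ?h ?ltr01.
(* The hypothesis covers only arguments up to 1, whence the minimum; [M + 1] avoids a division by
   zero. *)
pose t := Num.min 1 (eps / (M + 1)).
have M1 : 0 < M + 1 by rewrite ltr_wpDl.
have t0 : 0 < t by rewrite /t lt_min ltr01 divr_gt0.
apply: le_trans (h t t0 _) _; first by rewrite /t ge_min lexx.
have le1 : t <= eps / (M + 1) by rewrite /t ge_min lexx orbT.
apply: (@le_trans _ _ ((M + 1) * (eps / (M + 1)))).
  by apply: ler_pM => //; [apply: ltW|rewrite lerDl].
by rewrite mulrCA divff ?mulr1 // gt_eqF.
Qed.

(** Integration of polynomials against a law with moments [d], the [L] of the introduction. *)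
Definition momfun d p := \sum_(i < size p) p`_i * d i.

Lemma momfun_widen d p k : (size p <= k)%N -> momfun d p = \sum_(i < k) p`_i * d i.
Proof.
move=> pk; rewrite /momfun (big_ord_widen k (fun i => p`_i * d i)) //.
rewrite big_mkcond; apply: eq_bigr => i _.
by case: ltnP => // h; rewrite nth_default // mul0r.
Qed.

Fact momfun_is_scalar d : scalar (momfun d).
Proof.
move=> a p q; pose k := maxn (size (a *: p + q)) (maxn (size p) (size q)).
rewrite !(@momfun_widen d _ k) ?leq_max ?leqnn ?orbT //.
rewrite mulr_sumr -big_split; apply: eq_bigr => i _ /=.
by rewrite coefD coefZ mulrDl mulrA.
Qed.

HB.instance Definition _ d :=
  GRing.isLinear.Build C {poly C} C _ (momfun d) (momfun_is_scalar d).

Lemma momfunD d p q : momfun d (p + q) = momfun d p + momfun d q.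
Proof. exact: linearD. Qed.

Lemma momfunB d p q : momfun d (p - q) = momfun d p - momfun d q.
Proof. exact: linearB. Qed.

Lemma momfunZ d c p : momfun d (c *: p) = c * momfun d p.
Proof. exact: linearZ. Qed.

Lemma momfunXn d k : momfun d 'X^k = d k.
Proof.
rewrite (@momfun_widen _ _ k.+1) ?size_polyXn // big_ord_recr /= coefXn eqxx mul1r.
rewrite big1 ?add0r // => i _; rewrite coefXn; case: eqP => [e|_]; last by rewrite mul0r.
by have := ltn_ord i; rewrite e ltnn.
Qed.

Lemma momfunC d (c : C) : momfun d c%:P = c * d 0%N.
Proof. by rewrite -[c%:P]mulr1 mul_polyC linearZ /= -(expr0 'X) momfunXn. Qed.

Lemma momfun_mulX d p : momfun d ('X * p) = momfun (fun i => d i.+1) p.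
Proof.
rewrite (@momfun_widen _ _ (size p).+1); last first.
  by rewrite (leq_trans (size_polyMleq _ _)) // size_polyX.
rewrite big_ord_recl coefXM mul0r add0r.
by apply: eq_bigr => i _; rewrite coefXM lift0.
Qed.

(** The polynomial [(p(X) - p(y)) / (X - y)], expanded monomial by monomial. *)
Definition divdiff y p : {poly C} :=
  \sum_(i < size p) p`_i *: \sum_(j < i) 'X^(i.-1 - j) * (y ^+ j)%:P.

Lemma divdiffE y p : ('X - y%:P) * divdiff y p = p - p.[y]%:P.
Proof.
rewrite /divdiff mulr_sumr horner_coef rmorph_sum -[X in _ = X - _]coefK poly_def -sumrB.
apply: eq_bigr => i _ /=; rewrite -scalerAr polyCM mul_polyC -scalerBr; congr (_ *: _).
rewrite [RHS](_ : _ = 'X ^+ i - y%:P ^+ i) ?rmorphXn // subrXX.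
by congr (_ * _); apply: eq_bigr => j _; rewrite rmorphXn.
Qed.

Lemma divdiff_unique y p q : ('X - y%:P) * q = p - p.[y]%:P -> divdiff y p = q.
Proof. by rewrite -divdiffE => /(mulfI (negbT (polyXsubC_eq0 y))). Qed.

Lemma divdiffM y p q :
  divdiff y (p * q) = divdiff y p * q + p.[y]%:P * divdiff y q.
Proof.
apply: divdiff_unique; rewrite mulrDr mulrA divdiffE mulrCA divdiffE hornerM polyCM.
ring.
Qed.

Lemma divdiffB y p q : divdiff y (p - q) = divdiff y p - divdiff y q.
Proof.
apply: divdiff_unique; rewrite mulrBr !divdiffE !hornerE polyCB; ring.
Qed.

Lemma divdiffC y c : divdiff y c%:P = 0.
Proof. by apply: divdiff_unique; rewrite mulr0 hornerC subrr. Qed.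

Lemma divdiffX y : divdiff y 'X = 1.
Proof. by apply: divdiff_unique; rewrite mulr1 hornerX. Qed.

(** The double integral of [(x^i - y^i) / (x - y)]; [momfun (moment_conv m n)] is thus the [D] of
    the introduction. At [i = 0] the sum is empty and [i.-1] is harmless. *)
Definition moment_conv m n i := \sum_(j < i) m (i.-1 - j)%N * n j.

(** The inner integral of the divided difference, over the first variable, as a polynomial in the
    second. *)
Definition momfun_divdiff m p : {poly C} :=
  \sum_(i < size p) p`_i *: \sum_(j < i) m (i.-1 - j)%N *: 'X^j.

Lemma horner_momfun_divdiff m p y : (momfun_divdiff m p).[y] = momfun m (divdiff y p).
Proof.
rewrite /momfun_divdiff /divdiff linear_sum horner_sum; apply: eq_bigr => i _ /=.
rewrite hornerZ linearZ /=; congr (_ * _); rewrite linear_sum horner_sum.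
apply: eq_bigr => j _ /=.
by rewrite hornerZ hornerXn mulrC [in RHS]mulrC mul_polyC linearZ /= momfunXn.
Qed.

Lemma momfun_momfun_divdiff m n p :
  momfun n (momfun_divdiff m p) = momfun (moment_conv m n) p.
Proof.
rewrite /momfun_divdiff linear_sum; apply: eq_bigr => i _ /=.
rewrite linearZ /=; congr (_ * _); rewrite linear_sum.
by apply: eq_bigr => j _; rewrite linearZ /= momfunXn.
Qed.

(** Stands for a law carried by [[-K, K]]. The constant 2 leaves room for estimating real and
    imaginary parts separately. *)
Definition bounded_on K m := forall p (eps : R),
  (forall x : R, `|x| <= K -> nc p.[x%:C%C] <= eps) -> nc (momfun m p) <= 2 * eps.

(** The functional is iterated, [m] in one variable and [n] in the other, so the constant 2 enters
    twice. *)
Lemma moment_conv_bounded K m n p (eps : R) :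
  bounded_on K m -> bounded_on K n ->
  (forall x y : R, `|x| <= K -> `|y| <= K -> nc (divdiff y%:C%C p).[x%:C%C] <= eps) ->
  nc (momfun (moment_conv m n) p) <= 4 * eps.
Proof.
move=> mK nK h; rewrite -momfun_momfun_divdiff.
have -> : 4 * eps = 2 * (2 * eps) :> R by ring.
apply: nK => y yK; rewrite horner_momfun_divdiff; apply: mK => x xK; exact: h.
Qed.

End MomentFunctionals.

(** * Polynomial approximation of the resolvent *)

Lemma mul_subr_conjc (R : realType) (u v x : R) :
  (Complex u v - x%:C%C) * ((Complex u v)^*%C - x%:C%C) = ((x - u) ^+ 2 + v ^+ 2)%:C%C.
Proof. by apply/eqP; rewrite eq_complex /=; apply/andP; split; apply/eqP; ring. Qed.

(** The product rule [divdiffM] gives the analogue of [(r^(N+1))' = (N+1) r^N r']. *)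
Lemma divdiff_exp_le (R : realType) (r : {poly R[i]}) (x y : R[i]) (t D : R) N :
  Normc.normc r.[x] <= t -> Normc.normc r.[y] <= t ->
  Normc.normc (divdiff y r).[x] <= D ->
  Normc.normc (divdiff y (r ^+ N.+1)).[x] <= N.+1%:R * t ^+ N * D.
Proof.
move=> rx ry rD; have t0 : 0 <= t by apply: le_trans (normc_ge0 _) rx.
elim: N => [|N IH]; first by rewrite expr1 expr0 !mul1r.
rewrite exprS divdiffM hornerD !hornerM hornerC horner_exp.
apply: le_trans (normc_leD _ _) _; rewrite !Normc.normcM normcX.
have -> : N.+2%:R * t ^+ N.+1 * D = D * t ^+ N.+1 + t * (N.+1%:R * t ^+ N * D).
  by rewrite -[N.+2%:R]natr1 (exprS _ N); ring.
rewrite lerD // ler_pM ?normc_ge0 ?exprn_ge0 ?normc_ge0 //.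
by apply: lerXn2r; rewrite ?nnegrE ?normc_ge0.
Qed.

Section Resolvent.
Variables (R : realType) (z : R[i]) (K : R).
Hypotheses (z_gt0 : 0 < complex.Im z) (K_ge0 : 0 <= K).
Local Notation C := R[i].
Local Notation nc := (@Normc.normc R).
Local Notation b := (complex.Im z).
Implicit Types (p q e : {poly C}) (m n : nat -> C) (x y eps : R).

(** The error of [p] as an approximation of [1 / (z - x)], multiplied by [z - x] so as to stay
    polynomial. *)
Definition residual p : {poly C} := 1 - (z%:P - 'X) * p.

Lemma geometric_small (s d : R) : 0 < s -> s < 1 -> 0 < d ->
  exists N : nat, s ^+ N <= d.
Proof.
move=> s0 s1 d0.
have s1' : `|s| < 1 by rewrite gtr0_norm.
have /cvgrPdist_le /(_ d d0) [N _ hN] := cvg_expr s1'.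
exists N; have := hN N (leqnn N); rewrite sub0r normrN; apply: le_trans.
exact: ler_norm.
Qed.

Lemma geometric_natmul_le (s : R) N : 0 < s -> s < 1 -> N.+1%:R * s ^+ N <= (1 - s)^-1.
Proof.
move=> s0 s1; have s1' : 0 < 1 - s by rewrite subr_gt0.
rewrite -div1r ler_pdivlMr //.
have le : N.+1%:R * s ^+ N <= \sum_(i < N.+1) s ^+ i.
  rewrite mulr_natl -[X in _ *+ X]card_ord -sumr_const; apply: ler_sum => i _.
  by rewrite ler_wiXn2l ?(ltW s0) ?(ltW s1) // -ltnS.
apply: (@le_trans _ _ ((\sum_(i < N.+1) s ^+ i) * (1 - s))); first by rewrite ler_wpM2r // ltW.
rewrite mulrC -opprB mulNr -subrX1 opprB gerBl exprn_ge0 //; exact: ltW.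
Qed.

(* With [r = 1 - (z - X)(z^* - X) / Lc], a polynomial that takes values in
   [0, 1 - (Im z)^2 / Lc] on [-K, K], the truncated Neumann series
   [p = (z^* - X) / Lc * sum_(i <= N) r^i] has residual [r^(N+1)]. *)
Lemma residual_small eps : 0 < eps -> exists p,
  (forall x, `|x| <= K -> nc (residual p).[x%:C%C] <= eps) /\
  (forall x y, `|x| <= K -> `|y| <= K ->
    nc (divdiff y%:C%C (residual p)).[x%:C%C] <= eps).
Proof.
move=> eps0; pose zb : C := (z^*)%C; pose a := complex.Re z.
pose Lc : R := (K + `|a|) ^+ 2 + b ^+ 2.
have b2 : 0 < b ^+ 2 by rewrite exprn_gt0.
have Lc0 : 0 < Lc by rewrite ltr_wpDl ?sqr_ge0.
pose c : C := (Lc^-1)%:C%C.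
pose r : {poly C} := 1 - c%:P * ((z%:P - 'X) * (zb%:P - 'X)).
pose rho := 1 - b ^+ 2 / Lc.
have rE x : r.[x%:C%C] = (1 - ((x - a) ^+ 2 + b ^+ 2) / Lc)%:C%C.
  have -> : r.[x%:C%C] = 1 - c * ((z - x%:C%C) * (zb - x%:C%C)) by rewrite /r !hornerE.
  have -> : (z - x%:C%C) * (zb - x%:C%C) = ((x - a) ^+ 2 + b ^+ 2)%:C%C.
    by rewrite /zb /a; case: (z) => u v; apply: mul_subr_conjc.
  by rewrite /c mulrC -rmorphM -rmorphB.
have rho1 : rho < 1 by rewrite /rho gtrBl divr_gt0.
have rho0 : 0 <= rho.
  by rewrite /rho subr_ge0 ler_pdivrMr // mul1r /Lc lerDr sqr_ge0.
have r_le x : `|x| <= K -> nc r.[x%:C%C] <= rho.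
  move=> xK; rewrite rE normc_real ger0_norm.
    by rewrite /rho lerD2l lerN2 ler_pM2r ?invr_gt0 // lerDr sqr_ge0.
  rewrite subr_ge0 ler_pdivrMr // mul1r /Lc lerD2r -real_normK ?num_real //.
  apply: lerXn2r; rewrite ?nnegrE ?addr_ge0 //.
  by apply: le_trans (ler_normB _ _) _; rewrite lerD2r.
(* Then [rho <= s^2] with [0 < s < 1]: one factor [s^N] of [(s^2)^N] absorbs the [N+1] of the
   divided difference, and the other one tends to 0. *)
pose s := (1 + rho) / 2.
have s0 : 0 < s by rewrite /s; lra.
have s1 : s < 1 by rewrite /s; lra.
have rho_s : rho <= s ^+ 2 by rewrite /s; have := sqr_ge0 (1 - rho); nra.
have r_le2 x : `|x| <= K -> nc r.[x%:C%C] <= s ^+ 2 by move=> /r_le h; apply: le_trans h rho_s.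
have ddr y : divdiff y%:C%C r = c%:P * ((z + zb - y%:C%C)%:P - 'X).
  rewrite /r divdiffB -polyC1 divdiffC !divdiffM divdiffC !divdiffB !divdiffC divdiffX.
  rewrite hornerC hornerD hornerN hornerC hornerX !(polyCB, polyCD, polyC1); ring.
pose D := nc c * (nc (z + zb) + K + K).
have D0 : 0 <= D by rewrite /D mulr_ge0 ?normc_ge0 // !addr_ge0 ?normc_ge0.
have ddr_le x y : `|x| <= K -> `|y| <= K -> nc (divdiff y%:C%C r).[x%:C%C] <= D.
  move=> xK yK; rewrite ddr !hornerE Normc.normcM ler_wpM2l ?normc_ge0 //.
  apply: le_trans (normc_leB _ _) _; rewrite normc_real lerD //.
  by apply: le_trans (normc_leB _ _) _; rewrite normc_real lerD.
have dd_le N x y : `|x| <= K -> `|y| <= K ->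
    nc (divdiff y%:C%C (r ^+ N.+1)).[x%:C%C] <= N.+1%:R * (s ^+ 2) ^+ N * D.
  by move=> xK yK; apply: divdiff_exp_le; rewrite ?r_le2 ?ddr_le.
have s1' : 0 < 1 - s by rewrite subr_gt0.
have M0 : 0 < 1 + D / (1 - s) by rewrite ltr_wpDr ?ltr01 // divr_ge0 // ltW.
(* In the divisor [1 + D / (1 - s)], the 1 serves the residual and [D / (1 - s)] its divided
   difference. *)
have [N hN] := geometric_small s0 s1 (divr_gt0 eps0 M0).
rewrite ler_pdivlMr // in hN.
exists (c%:P * (zb%:P - 'X) * \sum_(i < N.+1) r ^+ i).
have -> : residual (c%:P * (zb%:P - 'X) * \sum_(i < N.+1) r ^+ i) = r ^+ N.+1.
  have -> : r ^+ N.+1 = 1 + (r ^+ N.+1 - 1) by rewrite addrC subrK.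
  by rewrite subrX1 /residual /r; ring.
have sN0 : 0 <= s ^+ N by rewrite exprn_ge0 // ltW.
split=> [x xK|x y xK yK].
  rewrite horner_exp normcX; apply: le_trans hN.
  apply: (@le_trans _ _ (s ^+ N)); last first.
    by rewrite mulrDr mulr1 lerDl mulr_ge0 // divr_ge0 // ltW.
  apply: (@le_trans _ _ ((s ^+ 2) ^+ N.+1)).
    by apply: lerXn2r; rewrite ?nnegrE ?normc_ge0 ?sqr_ge0 ?r_le2.
  rewrite -exprM; apply: ler_wiXn2l; rewrite ?(ltW s0) ?(ltW s1) //.
  by rewrite (leq_trans (leqnSn N)) // leq_pmull.
apply: le_trans (dd_le N x y xK yK) _; apply: le_trans hN.
rewrite -exprM mul2n -addnn exprD.
have := geometric_natmul_le N s0 s1.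
have -> : N.+1%:R * (s ^+ N * s ^+ N) * D = s ^+ N * (D * (N.+1%:R * s ^+ N)) by ring.
move=> h; rewrite ler_wpM2l //; apply: (@le_trans _ _ (D / (1 - s))); last by rewrite lerDr.
by rewrite ler_wpM2l.
Qed.

(** [G] is the value at [1 / (z - x)] of the functional with moments [m]: dividing the residual by
    [z - x] costs a factor [1 / b], and 2 is the constant of [bounded_on]. *)
Definition resolvent_value m (G : C) := forall p eps,
  (forall x, `|x| <= K -> nc (residual p).[x%:C%C] <= eps) ->
  nc (momfun m p - G) <= 2 * (eps / b).

(** The divided difference of [1 / (z - x)] is the product [1 / ((z - x)(z - y))], so its double
    integral is [G G']. For an approximating [p] this product form holds up to a multiple of
    [eps]. *)
Lemma moment_conv_resolvent m n G G' :
  bounded_on K m -> bounded_on K n ->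
  resolvent_value m G -> resolvent_value n G' ->
  exists2 M : R, 0 <= M & forall eps, 0 < eps -> eps <= 1 -> exists p,
  [/\ forall x, `|x| <= K -> nc (residual p).[x%:C%C] <= eps,
      forall x y, `|x| <= K -> `|y| <= K ->
        nc (divdiff y%:C%C (residual p)).[x%:C%C] <= eps
    & nc (momfun (moment_conv m n) p - G * G') <= M * eps].
Proof.
move=> mK nK mG nG.
pose S := (2 / b + 1) / b.
have bV : 0 < b^-1 by rewrite invr_gt0.
have S0 : 0 <= S by rewrite /S mulr_ge0 ?addr_ge0 ?mulr_ge0 ?ltW.
(* The summands come from replacing the divided difference of [p] by [p(x) p(y)], then [momfun m p]
   by [G], then [momfun n p] by [G']. *)
exists (4 * S + 8 / b ^+ 2 + 2 * nc G / b).
  have h1 : 0 <= 8 / b ^+ 2 by rewrite divr_ge0 ?sqr_ge0.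
  have h2 : 0 <= 2 * nc G / b by rewrite divr_ge0 ?(ltW z_gt0) // mulr_ge0 ?normc_ge0.
  by rewrite !addr_ge0 // mulr_ge0.
move=> eps eps0 eps1; have [p [he hde]] := residual_small eps0.
exists p; split => //; set e := residual p in he hde.
have eE : e = 1 - (z%:P - 'X) * p by [].
have p_le x : `|x| <= K -> nc p.[x%:C%C] <= 2 / b.
  move=> xK; rewrite ler_pdivlMr //.
  have h : (z - x%:C%C) * p.[x%:C%C] = 1 - e.[x%:C%C] by rewrite eE !hornerE /=; ring.
  have : nc (1 - e.[x%:C%C]) <= 2.
    apply: le_trans (normc_leB _ _) _; rewrite Normc.normc1.
    by have := he x xK; lra.
  rewrite -h Normc.normcM; apply: le_trans.
  by rewrite mulrC ler_wpM2r ?normc_ge0 ?normc_subr_ge.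
have Mp : nc (momfun n p) <= 2 * (2 / b) by apply: nK.
have dde y : divdiff y%:C%C e = p.[y%:C%C]%:P - (z%:P - 'X) * divdiff y%:C%C p.
  rewrite eE [_ * p]mulrC divdiffB -polyC1 divdiffC divdiffM divdiffB divdiffC divdiffX.
  by ring.
have Sle x y : `|x| <= K -> `|y| <= K ->
    nc (divdiff y%:C%C p - p.[y%:C%C] *: p).[x%:C%C] <= S * eps.
  move=> xK yK; set s := _.[_].
  have h : (z - x%:C%C) * s = p.[y%:C%C] * e.[x%:C%C] - (divdiff y%:C%C e).[x%:C%C].
    by rewrite /s dde eE !hornerE /=; ring.
  rewrite /S mulrAC ler_pdivlMr // mulrC.
  apply: (@le_trans _ _ (nc ((z - x%:C%C) * s))).
    by rewrite Normc.normcM ler_wpM2r ?normc_ge0 ?normc_subr_ge.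
  rewrite h; apply: le_trans (normc_leB _ _) _; rewrite mulrDl mul1r lerD ?hde //.
  by rewrite Normc.normcM ler_pM ?normc_ge0 ?p_le ?he.
clearbody S.
have LM : nc (momfun (moment_conv m n) p - momfun m p * momfun n p) <= 4 * S * eps.
  have -> : momfun (moment_conv m n) p - momfun m p * momfun n p =
      momfun n (momfun_divdiff m p - momfun m p *: p).
    by rewrite momfunB momfunZ momfun_momfun_divdiff.
  have -> : 4 * S * eps = 2 * (2 * (S * eps)) by ring.
  apply: nK => y yK; rewrite hornerD hornerN hornerZ horner_momfun_divdiff.
  have -> : momfun m (divdiff y%:C%C p) - momfun m p * p.[y%:C%C] =
      momfun m (divdiff y%:C%C p - p.[y%:C%C] *: p).
    by rewrite momfunB momfunZ [momfun m p * _]mulrC.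
  by apply: mK => x xK; apply: Sle.
have -> : momfun (moment_conv m n) p - G * G' =
   (momfun (moment_conv m n) p - momfun m p * momfun n p) +
   ((momfun m p - G) * momfun n p + G * (momfun n p - G')) by ring.
have -> : (4 * S + 8 / b ^+ 2 + 2 * nc G / b) * eps =
   4 * S * eps + (8 / b ^+ 2 * eps + 2 * nc G / b * eps) by ring.
apply: le_trans (normc_leD _ _) _; apply: lerD => //.
apply: le_trans (normc_leD _ _) _; rewrite !Normc.normcM; apply: lerD.
  have -> : 8 / b ^+ 2 * eps = 2 * (eps / b) * (2 * (2 / b)).
    by field; rewrite gt_eqF.
  by rewrite ler_pM ?normc_ge0 ?mG.
have -> : 2 * nc G / b * eps = nc G * (2 * (eps / b)) by ring.
by rewrite ler_wpM2l ?normc_ge0 ?nG.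
Qed.

(** The hypothesis on [m] says [L (X p) = D p]. As [p] tends to [1 / (z - x)], [X p] tends to
    [z / (z - x) - 1], and the limit reads [z G - 1 = G G']. *)
Lemma resolvent_recursion m n G G' :
  bounded_on K m -> bounded_on K n ->
  resolvent_value m G -> resolvent_value n G' ->
  m 0%N = 1 -> (forall i, m i.+1 = moment_conv m n i) ->
  G * (z - G') = 1.
Proof.
move=> mK nK mG nG m0 mS.
have [M M0 hM] := moment_conv_resolvent mK nK mG nG.
apply/eqP; rewrite -subr_eq0; apply/eqP.
apply: (@normc_small_eq0 _ _ (nc z * (2 / b) + 2 + M)) => eps eps0 eps1.
have [p [he _ hc]] := hM eps eps0 eps1.
have e1 : momfun (moment_conv m n) p = momfun m ('X * p).
  by rewrite momfun_mulX; apply: eq_bigr => i _; rewrite mS.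
have e2 : 'X * p = z *: p - 1 + residual p.
  by rewrite /residual -mul_polyC; ring.
have e3 : momfun (moment_conv m n) p = z * momfun m p - 1 + momfun m (residual p).
  by rewrite e1 e2 momfunD momfunB momfunZ -polyC1 momfunC m0 mul1r.
have -> : G * (z - G') - 1 =
  - (z * (momfun m p - G)) - momfun m (residual p) + (momfun (moment_conv m n) p - G * G').
  by rewrite e3; ring.
apply: le_trans (normc_leD _ _) _; rewrite [X in _ <= X]mulrDl lerD //.
apply: le_trans (normc_leB _ _) _; rewrite [X in _ <= X]mulrDl normc_opp lerD //.
  rewrite Normc.normcM -mulrA ler_wpM2l ?normc_ge0 //.
  have -> : 2 / b * eps = 2 * (eps / b) by ring.
  exact: mG.
by apply: mK.
Qed.

(** The doubling of [moment_conv m m] says [D ((X^2 - 2) p) = 0]. Since [(x^2 - 2) / (z - x) = (z^2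
    - 2) / (z - x) - (z + x)] and [D (z + X) = 1], the limit is the claim. *)
Lemma resolvent_arcsine m G :
  bounded_on K m -> resolvent_value m G ->
  moment_conv m m 1%N = 1 ->
  (forall i, moment_conv m m i.+2 = 2 * moment_conv m m i) ->
  (z ^+ 2 - 2) * G ^+ 2 = 1.
Proof.
move=> mK mG d1 dS; set d := moment_conv m m in d1 dS.
have d0 : d 0%N = 0 by rewrite /d /moment_conv big_ord0.
have [M M0 hM] := moment_conv_resolvent mK mK mG mG.
apply/eqP; rewrite -subr_eq0; apply/eqP.
apply: (@normc_small_eq0 _ _ (nc (z ^+ 2 - 2) * M + 4 * (nc z + K + 1))) => eps eps0 eps1.
have [p [he hde hc]] := hM eps eps0 eps1; rewrite -/d in hc.
have e1 : momfun d (('X^2 - 2%:P) * p) = 0.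
  rewrite mulrBl momfunB expr2 -mulrA !momfun_mulX mul_polyC momfunZ.
  apply/eqP; rewrite subr_eq0 /momfun mulr_sumr; apply/eqP; apply: eq_bigr => i _.
  by rewrite dS mulrCA.
set q := (z%:P + 'X) * residual p.
have e2 : ('X^2 - 2%:P) * p = (z ^+ 2 - 2) *: p - (z%:P + 'X) + q.
  rewrite /q /residual -mul_polyC !(polyCB, polyCM, polyC1) /=; ring.
have e3 : (z ^+ 2 - 2) * momfun d p = 1 - momfun d q.
  have mX : momfun d 'X = 1 by rewrite -['X]expr1 momfunXn.
  move: e1; rewrite e2 momfunD momfunB momfunZ momfunD momfunC d0 mX => h.
  by apply/eqP; rewrite -subr_eq0 -h; apply/eqP; ring.
have -> : (z ^+ 2 - 2) * G ^+ 2 - 1 =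
    - ((z ^+ 2 - 2) * (momfun d p - G * G)) - momfun d q.
  by rewrite mulrBr e3; ring.
apply: le_trans (normc_leB _ _) _; rewrite [X in _ <= X]mulrDl normc_opp.
apply: lerD.
  by rewrite Normc.normcM -mulrA ler_wpM2l ?normc_ge0.
rewrite -mulrA; apply: (moment_conv_bounded mK mK) => x y xK yK.
(* By the product rule, smallness of [D q] needs the divided difference of the residual to be small,
   not only the residual. *)
have -> : divdiff y%:C%C q = residual p + (z + y%:C%C)%:P * divdiff y%:C%C (residual p).
  rewrite /q divdiffM hornerD hornerC hornerX; congr (_ + _).
  by rewrite -[X in _ = X]mul1r; congr (_ * _); apply: divdiff_unique; rewrite !hornerE polyCD /=; ring.
rewrite hornerD hornerM hornerC; apply: le_trans (normc_leD _ _) _; rewrite [X in _ <= X]mulrDl mul1r addrC.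
rewrite lerD ?he // Normc.normcM ler_pM ?normc_ge0 ?hde //.
by apply: le_trans (normc_leD _ _) _; rewrite normc_real lerD2l.
Qed.

End Resolvent.

(** * Cauchy transforms *)

Section BoundedSupport.
Variables (R : realType) (mu : probability R R).
Implicit Types (K x : R) (h : R -> R).

Let tail K : set R := [set x | K < `|x|]%classic.

Lemma measurable_tail K : measurable (tail K).
Proof.
have -> : tail K = (setT `&` (@Num.norm R R @^-1` `]K, +oo[%classic))%classic.
  by rewrite setTI; apply/seteqP; split => x /=; rewrite in_itv /= andbT.
exact: normr_measurable.
Qed.

(** Markov's inequality for [x^(2k)] bounds the mass of the tail by [(B / K^2)^k], which tends to
    0. *)
Lemma tail_null (mom : nat -> R) K (B : R) : 0 < K -> 0 < B -> B < K ^+ 2 ->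
  (forall k, mu.-integrable setT (fun x => (x ^+ k)%:E)) ->
  (forall k, \int[mu]_x (x ^+ k)%:E = (mom k)%:E)%E ->
  (forall k, mom k.*2 <= B ^+ k) -> mu (tail K) = 0%E.
Proof.
move=> K0 B0 BK hint hmom hB; have mA := measurable_tail K.
have fA : mu (tail K) \is a fin_num by apply: fin_num_measure.
pose t := fine (mu (tail K)).
have tE : mu (tail K) = t%:E by rewrite /t fineK.
have t0 : 0 <= t by rewrite -lee_fin -tE measure_ge0.
have main k : (K ^+ 2) ^+ k * t <= B ^+ k.
  apply: le_trans (hB k); rewrite -lee_fin -hmom EFinM -tE.
  rewrite -(integral_cst mu mA ((K ^+ 2) ^+ k)%:E).
  have mx : measurable_fun setT (EFin \o (fun x : R => x ^+ k.*2))
    by apply: measurable_int (hint _).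
  have xk0 x : (0 <= (x ^+ k.*2)%:E)%E.
    by rewrite lee_fin -mul2n exprM exprn_ge0 // sqr_ge0.
  apply: (@le_trans _ _ (\int[mu]_(x in tail K) (x ^+ k.*2)%:E)%E); last first.
    by apply: ge0_subset_integral.
  apply: ge0_le_integral => //.
  - by move=> x _; rewrite lee_fin exprn_ge0 // sqr_ge0.
  - exact: measurable_funTS.
  - move=> x /= Kx; rewrite lee_fin -mul2n exprM lerXn2r ?nnegrE ?sqr_ge0 //.
    by rewrite -(real_normK (num_real x)) lerXn2r ?nnegrE ?(ltW K0) ?(ltW Kx).
rewrite tE; congr (_%:E); apply/eqP; rewrite eq_le t0 andbT leNgt; apply/negP => tp.
have K2 : 0 < K ^+ 2 by rewrite exprn_gt0.
have s0 : 0 < B / K ^+ 2 by rewrite divr_gt0.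
have s1 : B / K ^+ 2 < 1 by rewrite ltr_pdivrMr // mul1r.
have t2 : 0 < t / 2 by rewrite divr_gt0.
have [N hN] := geometric_small s0 s1 t2.
have : t <= t / 2.
  apply: le_trans hN; rewrite expr_div_n ler_pdivlMr ?exprn_gt0 //.
  by rewrite mulrC main.
by lra.
Qed.

Lemma bounded_integral K h (eps : R) : mu (tail K) = 0%E ->
  measurable_fun setT h -> (forall x, `|x| <= K -> `|h x| <= eps) -> 0 <= eps ->
  mu.-integrable setT (EFin \o h) /\ `|Rintegral mu setT h| <= eps.
Proof.
move=> tK mh hK eps0.
have mA := measurable_tail K.
have mE : measurable_fun setT (EFin \o h) by apply/measurable_EFinP.
have mD : measurable (setT `\` tail K : set R)%classic by apply: measurableD.
have hD x : (setT `\` tail K)%classic x -> `|h x| <= eps.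
  by move=> [_ /= /negP]; rewrite -leNgt => /hK.
have ih : mu.-integrable setT (EFin \o h).
  apply/(negligible_integrable mA _ mE tK) => //.
  apply: (le_integrable mD (g := EFin \o cst eps)).
  - exact: measurable_funTS.
  - by move=> x /hD hx; rewrite /= lee_fin [X in _ <= X]ger0_norm.
  - exact: finite_measure_integrable_cst.
split => //; rewrite -lee_fin EFin_normr_Rintegral //.
apply: le_trans (le_abse_integral _ _ _) _ => //.
rewrite (ge0_negligible_integral mA _ _ _ tK) //; last exact: measurableT_comp.
apply: (@le_trans _ _ (\int[mu]_(x in setT `\` tail K) cst eps%:E x)%E).
  apply: ge0_le_integral => //.
  by apply: measurable_funTS; apply: measurableT_comp.
rewrite integral_cst // -[X in (_ <= X)%E]mule1 lee_wpmul2l ?lee_fin //.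
exact: probability_le1.
Qed.

Lemma integral_power_sum (mom : nat -> R) (c : nat -> R) n :
  (forall k, mu.-integrable setT (fun x => (x ^+ k)%:E)) ->
  (forall k, \int[mu]_x (x ^+ k)%:E = (mom k)%:E)%E ->
  mu.-integrable setT (EFin \o (fun x => \sum_(i < n) c i * x ^+ i)) /\
  Rintegral mu setT (fun x => \sum_(i < n) c i * x ^+ i) = \sum_(i < n) c i * mom i.
Proof.
move=> hint hmom; elim: n => [|n [IH1 IH2]].
  have e : (fun x : R => \sum_(i < 0) c i * x ^+ i) = cst 0.
    by apply/funext => x; rewrite big_ord0.
  rewrite e big_ord0; split; first exact: finite_measure_integrable_cst.
  by rewrite Rintegral_cst // mul0r.
have e : (fun x : R => \sum_(i < n.+1) c i * x ^+ i) =
    (fun x => (\sum_(i < n) c i * x ^+ i) + c n * x ^+ n).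
  by apply/funext => x; rewrite big_ord_recr.
have i1 : mu.-integrable setT (EFin \o (fun x : R => x ^+ n)) by apply: hint.
have i2 : mu.-integrable setT (EFin \o (fun x : R => c n * x ^+ n)).
  by apply: (integrableZl _ (c n) i1).
rewrite e; split.
  by apply: (integrableD _ IH1 i2).
rewrite RintegralD // IH2 RintegralZl // big_ord_recr /=; congr (_ + _ * _).
by rewrite /Rintegral hmom.
Qed.

End BoundedSupport.

Section CauchyTransform.
Variables (R : realType) (mu : probability R R) (mom : nat -> R) (K : R).
Hypothesis hint : forall k, mu.-integrable setT (fun x : R => (x ^+ k)%:E).
Hypothesis hmom : forall k, (\int[mu]_x (x ^+ k)%:E = (mom k)%:E)%E.
Hypothesis tail0 : mu [set x | K < `|x|]%classic = 0%E.
Hypothesis K_ge0 : 0 <= K.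
Local Notation nc := (@Normc.normc R).
Local Notation cmom := (fun k => (mom k)%:C%C).

Lemma Re_sum I (s : seq I) (F : I -> R[i]) :
  complex.Re (\sum_(i <- s) F i) = \sum_(i <- s) complex.Re (F i).
Proof. by apply: (big_morph _ (id1 := 0) (op1 := +%R)) => // -[? ?] [? ?]. Qed.

Lemma Im_sum I (s : seq I) (F : I -> R[i]) :
  complex.Im (\sum_(i <- s) F i) = \sum_(i <- s) complex.Im (F i).
Proof. by apply: (big_morph _ (id1 := 0) (op1 := +%R)) => // -[? ?] [? ?]. Qed.

Lemma Re_mulr_real (u : R[i]) (x : R) : complex.Re (u * x%:C%C) = complex.Re u * x.
Proof. by case: u => a b /=; rewrite mulr0 subr0. Qed.

Lemma Im_mulr_real (u : R[i]) (x : R) : complex.Im (u * x%:C%C) = complex.Im u * x.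
Proof. by case: u => a b /=; rewrite mulr0 add0r. Qed.

Lemma Re_horner_real (p : {poly R[i]}) (x : R) : complex.Re p.[x%:C%C] =
  \sum_(i < size p) complex.Re p`_i * x ^+ i.
Proof.
by rewrite horner_coef Re_sum; apply: eq_bigr => i _; rewrite -rmorphXn Re_mulr_real.
Qed.

Lemma Im_horner_real (p : {poly R[i]}) (x : R) : complex.Im p.[x%:C%C] =
  \sum_(i < size p) complex.Im p`_i * x ^+ i.
Proof.
by rewrite horner_coef Im_sum; apply: eq_bigr => i _; rewrite -rmorphXn Im_mulr_real.
Qed.

Lemma Re_horner_integral (p : {poly R[i]}) :
  mu.-integrable setT (EFin \o (fun x : R => complex.Re p.[x%:C%C])) /\
  Rintegral mu setT (fun x : R => complex.Re p.[x%:C%C]) = complex.Re (momfun cmom p).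
Proof.
have -> : (fun x : R => complex.Re p.[x%:C%C]) =
  (fun x => \sum_(i < size p) complex.Re p`_i * x ^+ i).
  by apply/funext => x; rewrite Re_horner_real.
have [h1 h2] := integral_power_sum (fun i => complex.Re p`_i) (size p) hint hmom.
split => //; rewrite h2 Re_sum.
by apply: eq_bigr => i _; rewrite Re_mulr_real.
Qed.

Lemma Im_horner_integral (p : {poly R[i]}) :
  mu.-integrable setT (EFin \o (fun x : R => complex.Im p.[x%:C%C])) /\
  Rintegral mu setT (fun x : R => complex.Im p.[x%:C%C]) = complex.Im (momfun cmom p).
Proof.
have -> : (fun x : R => complex.Im p.[x%:C%C]) =
  (fun x => \sum_(i < size p) complex.Im p`_i * x ^+ i).
  by apply/funext => x; rewrite Im_horner_real.
have [h1 h2] := integral_power_sum (fun i => complex.Im p`_i) (size p) hint hmom.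
split => //; rewrite h2 Im_sum.
by apply: eq_bigr => i _; rewrite Im_mulr_real.
Qed.

Lemma moments_bounded_on : bounded_on K cmom.
Proof.
move=> p eps hp; have eps0 : 0 <= eps.
  by apply: le_trans (normc_ge0 _) (hp 0 _); rewrite normr0.
have [i1 e1] := Re_horner_integral p; have [i2 e2] := Im_horner_integral p.
have mR : measurable_fun setT (fun x : R => complex.Re p.[x%:C%C]).
  by apply/measurable_EFinP; apply: measurable_int i1.
have mI : measurable_fun setT (fun x : R => complex.Im p.[x%:C%C]).
  by apply/measurable_EFinP; apply: measurable_int i2.
have [|_ b1] := bounded_integral tail0 mR _ eps0.
  by move=> x xK; apply: le_trans (normc_Re _) (hp x xK).
have [|_ b2] := bounded_integral tail0 mI _ eps0.
  by move=> x xK; apply: le_trans (normc_Im _) (hp x xK).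
apply: le_trans (normc_le_ReIm _) _; rewrite -e1 -e2; lra.
Qed.

Variable z : R[i].
Hypothesis z_gt0 : 0 < complex.Im z.

Let inv_sqr_measurable :
  measurable_fun setT (fun x : R => ((complex.Re z - x) ^+ 2 + complex.Im z ^+ 2)^-1).
Proof.
apply: continuous_measurable_fun => x; apply: cvgV.
  by rewrite gt_eqF // ltr_wpDl ?sqr_ge0 ?exprn_gt0.
apply: cvgD; last exact: cvg_cst.
by rewrite expr2; apply: cvgM; apply: cvgB;
  [exact: cvg_cst|exact: cvg_id|exact: cvg_cst|exact: cvg_id].
Qed.

Lemma Re_resolvent (x : R) : complex.Re ((z - x%:C%C)^-1) =
  (complex.Re z - x) * ((complex.Re z - x) ^+ 2 + complex.Im z ^+ 2)^-1.
Proof. by case: (z) => a b /=; rewrite subr0. Qed.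

Lemma Im_resolvent (x : R) : complex.Im ((z - x%:C%C)^-1) =
  - (complex.Im z * ((complex.Re z - x) ^+ 2 + complex.Im z ^+ 2)^-1).
Proof. by case: (z) => a b /=; rewrite subr0. Qed.

Lemma measurable_Re_resolvent :
  measurable_fun setT (fun x : R => complex.Re ((z - x%:C%C)^-1)).
Proof.
under eq_fun do rewrite Re_resolvent.
by apply: measurable_funM => //; apply: measurable_funB.
Qed.

Lemma measurable_Im_resolvent :
  measurable_fun setT (fun x : R => complex.Im ((z - x%:C%C)^-1)).
Proof.
under eq_fun do rewrite Im_resolvent.
by apply: measurableT_comp => //; apply: measurable_funM.
Qed.

Lemma normc_resolvent (x : R) : nc (z - x%:C%C)^-1 <= (complex.Im z)^-1.
Proof.
rewrite Normc.normcV lef_pV2 ?posrE ?normc_subr_ge //.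
by apply: lt_le_trans z_gt0 (normc_subr_ge _ _).
Qed.

(** On [[-K, K]] the difference [p(x) - 1 / (z - x)] is minus the residual divided by [z - x];
    integrating its real and imaginary parts gives the factor 2. *)
Lemma cauchy_resolvent_value : resolvent_value z K cmom (cauchy_transform mu z).
Proof.
move=> p eps hp; have eps0 : 0 <= eps.
  by apply: le_trans (normc_ge0 _) (hp 0 _); rewrite normr0.
have bV0 : 0 <= (complex.Im z)^-1 by rewrite invr_ge0 ltW.
have epsb : 0 <= eps / complex.Im z by rewrite mulr_ge0.
have [i1 e1] := Re_horner_integral p; have [i2 e2] := Im_horner_integral p.
have iR : mu.-integrable setT (EFin \o (fun x : R => complex.Re ((z - x%:C%C)^-1))).
  apply: (bounded_integral tail0 measurable_Re_resolvent _ bV0).1.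
  by move=> x _; apply: le_trans (normc_Re _) (normc_resolvent x).
have iI : mu.-integrable setT (EFin \o (fun x : R => complex.Im ((z - x%:C%C)^-1))).
  apply: (bounded_integral tail0 measurable_Im_resolvent _ bV0).1.
  by move=> x _; apply: le_trans (normc_Im _) (normc_resolvent x).
have mR : measurable_fun setT (fun x : R => complex.Re p.[x%:C%C] - complex.Re ((z - x%:C%C)^-1)).
  apply: measurable_funB; last exact: measurable_Re_resolvent.
  by apply/measurable_EFinP; apply: measurable_int i1.
have mI : measurable_fun setT (fun x : R => complex.Im p.[x%:C%C] - complex.Im ((z - x%:C%C)^-1)).
  apply: measurable_funB; last exact: measurable_Im_resolvent.
  by apply/measurable_EFinP; apply: measurable_int i2.
have key (x : R) : `|x| <= K -> nc (p.[x%:C%C] - (z - x%:C%C)^-1) <= eps / complex.Im z.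
  move=> xK.
  have zx : z - x%:C%C != 0.
    apply/eqP => h; have := normc_subr_ge z x; rewrite h Normc.normc0.
    by rewrite leNgt z_gt0.
  have -> : p.[x%:C%C] - (z - x%:C%C)^-1 = - ((residual z p).[x%:C%C] * (z - x%:C%C)^-1).
    rewrite /residual hornerD hornerN hornerM hornerD hornerN !hornerC hornerX.
    by field.
  by rewrite normc_opp Normc.normcM ler_pM ?normc_ge0 ?hp ?normc_resolvent.
have [|_ b1] := bounded_integral tail0 mR _ epsb.
  move=> x /key; apply: le_trans; have := normc_Re (p.[x%:C%C] - (z - x%:C%C)^-1).
  by case: (p.[_]) => ? ?; case: (_^-1) => ? ?.
have [|_ b2] := bounded_integral tail0 mI _ epsb.
  move=> x /key; apply: le_trans; have := normc_Im (p.[x%:C%C] - (z - x%:C%C)^-1).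
  by case: (p.[_]) => ? ?; case: (_^-1) => ? ?.
rewrite RintegralB // e1 in b1; rewrite RintegralB // e2 in b2.
apply: le_trans (normc_le_ReIm _) _; rewrite /cauchy_transform.
case: (momfun _ p) b1 b2 => u v /= b1 b2; lra.
Qed.

Lemma Im_cauchy_transform_le0 : complex.Im (cauchy_transform mu z) <= 0.
Proof.
rewrite /cauchy_transform /= -oppr_ge0.
have iI : mu.-integrable setT (EFin \o (fun x : R => complex.Im ((z - x%:C%C)^-1))).
  have bV0 : 0 <= (complex.Im z)^-1 by rewrite invr_ge0 ltW.
  apply: (bounded_integral tail0 measurable_Im_resolvent _ bV0).1.
  by move=> x _; apply: le_trans (normc_Im _) (normc_resolvent x).
rewrite -mulN1r -RintegralZl //; apply: Rintegral_ge0 => x _.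
rewrite Im_resolvent mulN1r opprK mulr_ge0 ?(ltW z_gt0) //.
by rewrite invr_ge0 addr_ge0 ?sqr_ge0.
Qed.

End CauchyTransform.

(** * The branch of the square root and the functional equations *)

Section Branch.
Variables (R : realType) (z : R[i]).
Hypothesis z_gt0 : 0 < complex.Im z.

(** A real root [c] would make [z^2] real, hence [z = i b] with [b > 0], and then
    [c^2 = - b^2 - 2 < 0]. *)
Lemma Im_sqrt_z2m2_gt0 : 0 < complex.Im (sqrt_z2m2 z).
Proof.
have sK : sqrt_z2m2 z ^+ 2 = z ^+ 2 - 2 by apply: sqrtCK.
have : 0 <= 'Im (sqrt_z2m2 z) by apply: Im_rootC_ge0.
rewrite -complexIm ler0c le_eqVlt => /orP[/eqP s0|//].
move: sK s0; case: (sqrt_z2m2 z) => c d /= sK d0; subst d.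
move: sK z_gt0; case: (z) => a b /eqP; rewrite !expr2 eq_complex /= => /andP[/eqP e1 /eqP e2] b0.
have a0 : a = 0.
  have /eqP : a * b = 0 by lra.
  by rewrite mulf_eq0 (gt_eqF b0) orbF => /eqP.
have c2 : 0 <= c * c by rewrite -expr2 sqr_ge0.
have b2 : 0 < b * b by rewrite mulr_gt0.
by move: e1; rewrite a0 mul0r; lra.
Qed.

(** The equation leaves [G = 1/s] or [G = -1/s] for the root [s]; as [Im s > 0], the second value
    has positive imaginary part. *)
Lemma inverse_sqrt_z2m2 (G : R[i]) : complex.Im G <= 0 ->
  (z ^+ 2 - 2) * G ^+ 2 = 1 -> G = (sqrt_z2m2 z)^-1.
Proof.
move=> G0; have sK : sqrt_z2m2 z ^+ 2 = z ^+ 2 - 2 by apply: sqrtCK.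
rewrite -sK -exprMn => /eqP; have s0 := Im_sqrt_z2m2_gt0.
move: (sqrt_z2m2 z) s0 => s s0.
have sn : s != 0 by apply/eqP => e; rewrite e ltxx in s0.
rewrite sqrf_eq1 => /orP[/eqP e|/eqP e].
  by apply: (mulfI sn); rewrite e divff.
have GE : G = - s^-1 by apply: (mulfI sn); rewrite e mulrN divff.
move: G0; rewrite GE; case: (s) s0 => c d /= d0.
rewrite opprK leNgt divr_gt0 // ltr_wpDl ?sqr_ge0 ?exprn_gt0 //.
Qed.

End Branch.

(** The even moments are at most [(m+2)^k], and [m + 2 < K^2]. [K] is left free so that two
    consecutive laws can share one interval. *)
Lemma mmon_resolvent (R : realType) (mu : probability R R) (m : nat) (z : R[i]) :
  has_mmon_moments m.+1 mu -> 0 < complex.Im z -> forall K : R, m.+2%:R <= K ->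
  let cmom := fun k => (mmon_moment R m.+1 k)%:C%C in
  [/\ bounded_on K cmom, resolvent_value z K cmom (cauchy_transform mu z)
    & complex.Im (cauchy_transform mu z) <= 0].
Proof.
move=> hm z0 K mK cmom.
have hint k := (hm k).1; have hmom k := (hm k).2.
have m2 : 1 < m.+2%:R :> R by rewrite ltr1n.
have K0 : 0 < K by apply: lt_le_trans mK; rewrite ltr0n.
have K2 : m.+2%:R < K ^+ 2.
  by apply: (le_lt_trans mK); rewrite expr2 ltr_pMr // (lt_le_trans m2 mK).
have tail0 : mu [set x | K < `|x|]%classic = 0%E.
  apply: (tail_null K0 _ K2 hint hmom) => [|k]; first by rewrite ltr0n.
  exact: mmon_moment_even_le.
split.
- exact: (moments_bounded_on hint hmom tail0 (ltW K0)).
- exact: (cauchy_resolvent_value hint hmom tail0 (ltW K0) z0).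
- exact: (Im_cauchy_transform_le0 tail0 z0).
Qed.

Lemma moment_conv_real (R : realType) (x y : nat -> R) i :
  moment_conv (fun k => (x k)%:C%C) (fun k => (y k)%:C%C) i =
  (\sum_(j < i) x (i.-1 - j)%N * y j)%:C%C.
Proof. by rewrite rmorph_sum; apply: eq_bigr => j _; rewrite rmorphM. Qed.

Theorem theorem7p2 (R : realType) (mu : nat -> probability R R)
  (hmu : forall m : nat, (1 <= m)%N -> has_mmon_moments m (mu m)) :
  forall z : R[i], 0 < complex.Im z ->
    cauchy_transform (mu 1%N) z = (sqrt_z2m2 z)^-1 /\
    (forall m : nat, (2 <= m)%N ->
       cauchy_transform (mu m) z = (z - cauchy_transform (mu m.-1) z)^-1).
Proof.
move=> z z0; split.
  have [mK mG GIm] := mmon_resolvent (hmu 1%N isT) z0 (lexx _).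
  apply: inverse_sqrt_z2m2 => //; apply: (resolvent_arcsine z0 _ mK mG) => [||i].
  - by rewrite ler0n.
  - by rewrite moment_conv_real mmon_moment1_conv.
  - rewrite !moment_conv_real !mmon_moment1_conv /= negbK.
    by case: ifP => _; rewrite ?mulr0 // exprS rmorphM /= rmorph_nat.
case=> [//|[//|m]] _.
have [mK mG _] := mmon_resolvent (hmu m.+2 isT) z0 (lexx _).
(* The larger radius, belonging to index [m.+2], serves both laws. *)
have [|nK nG _] := mmon_resolvent (hmu m.+1 isT) z0 (K := m.+3%:R).
  by rewrite ler_nat.
have e : cauchy_transform (mu m.+2) z * (z - cauchy_transform (mu m.+1) z) = 1.
  apply: (resolvent_recursion z0 _ mK nK mG nG) => [||i].
  - by rewrite ler0n.
  - by rewrite mmon_momentE /interleave0 /= onc_ratio0.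
  - by rewrite moment_conv_real -mmon_moment_rec.
have h0 : z - cauchy_transform (mu m.+1) z != 0.
  by apply/eqP => h; move: e; rewrite h mulr0 => /esym/eqP; rewrite oner_eq0.
by apply: (mulIf h0); rewrite e mulVf.
Qed.
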